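(* Let $L$ be a finite dimensional Lie algebra over a field $k$, let $U(L)$ be its universal enveloping algebra and $I\subset U(L)$ the augmentation ideal. The graded Rees algebra $U(L)^*=\bigoplus_{n\ge 0}I^n$ is graded left Noetherian if and only if $L$ is nilpotent.
   Context: The Rees algebra is $U(L)^*=\bigoplus_{n\ge 0}I^n=U(L)\oplus I\oplus I^2\oplus\cdots$ (with $I^0=U(L)$), graded by $n$, with multiplication given by the products $I^m\times I^n\to I^{m+n}$ in $U(L)$. Graded left Noetherian means that every graded left ideal is finitely generated. *)

(* Defs.v *)
From HB Require Import structures.
From mathcomp Require Import all_boot all_algebra.
From mathcomp Require Import boolp classical_sets.

Set Implicit Arguments.
Unset Strict Implicit.
Unset Printing Implicit Defensive.

Import GRing.Theory.

Local Open Scope ring_scope.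
Local Open Scope quotient_scope.

HB.mixin Record isLieAlgebra (k : fieldType) L of GRing.Lmodule k L := {
  bracket : L -> L -> L;
  linear_bracketl : forall y, linear (fun x => bracket x y);
  linear_bracketr : forall x, linear (fun y => bracket x y);
  bracketxx : forall x, bracket x x = 0;
  jacobi : forall x y z,
    bracket x (bracket y z) + bracket y (bracket z x)
      + bracket z (bracket x y) = 0
}.

#[short(type="lieAlgType")]
HB.structure Definition LieAlgebra (k : fieldType) :=
  {L of isLieAlgebra k L & GRing.Lmodule k L}.

(* A [vectType] is finite dimensional, so this is a finite dimensional Lie
   algebra. *)
#[short(type="finLieAlgType")]
HB.structure Definition FinLieAlgebra (k : fieldType) :=
  {L of LieAlgebra k L & Vector k L}.

(* [lower_central L n] is the n-th term of the lower central series, starting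
   at [lower_central L 0 = L]; the next term is the span of the brackets [x, y]
   with y in the current one. *)
Fixpoint lower_central (k : fieldType) (L : lieAlgType k) (n : nat) : set L :=
  if n is n'.+1 then
    [set z | exists (m : nat) (c : 'I_m -> k) (x y : 'I_m -> L),
       (forall i, lower_central n' (y i)) /\
       z = \sum_i c i *: bracket (x i) (y i)]%classic
  else setT.

Arguments lower_central {k} L n.

Definition nilpotent_lie (k : fieldType) (L : lieAlgType k) : Prop :=
  exists n, forall x, lower_central L n x -> x = 0.

Definition is_lie_hom (k : fieldType) (L : lieAlgType k) (A : algType k)
    (f : L -> A) : Prop :=
  linear f /\ forall x y, f (bracket x y) = f x * f y - f y * f x.

(* U(L) is the associative unital k-algebra presented by generators
   [EGen x], x in L, and the relations saying that x |-> [EGen x] is linear and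
   turns brackets into commutators.  It is built as the set of formal algebra
   expressions modulo the congruence generated by the algebra axioms and these
   relations; its universal property is [envelope_lift_gen] and
   [envelope_lift_unique] below. *)
Inductive envelope_expr (k : fieldType) (L : lieAlgType k) : Type :=
  | EGen of L
  | EScal of k
  | EAdd of envelope_expr L & envelope_expr L
  | EMul of envelope_expr L & envelope_expr L.

Arguments EGen {k L}.
Arguments EScal {k L}.

HB.instance Definition _ (k : fieldType) (L : lieAlgType k) :=
  gen_eqMixin (envelope_expr L).
HB.instance Definition _ (k : fieldType) (L : lieAlgType k) :=
  gen_choiceMixin (envelope_expr L).

Inductive envelope_cong (k : fieldType) (L : lieAlgType k) :
    envelope_expr L -> envelope_expr L -> Prop :=
  | ec_refl s : envelope_cong s s
  | ec_sym s t : envelope_cong s t -> envelope_cong t s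
  | ec_trans s t u : envelope_cong s t -> envelope_cong t u -> envelope_cong s u
  | ec_add s s' t t' : envelope_cong s s' -> envelope_cong t t' ->
      envelope_cong (EAdd s t) (EAdd s' t')
  | ec_mul s s' t t' : envelope_cong s s' -> envelope_cong t t' ->
      envelope_cong (EMul s t) (EMul s' t')
  | ec_addA s t u :
      envelope_cong (EAdd s (EAdd t u)) (EAdd (EAdd s t) u)
  | ec_addC s t : envelope_cong (EAdd s t) (EAdd t s)
  | ec_add0 s : envelope_cong (EAdd (EScal 0) s) s
  | ec_addN s : envelope_cong (EAdd (EMul (EScal (- 1)) s) s) (EScal 0)
  | ec_mulA s t u :
      envelope_cong (EMul s (EMul t u)) (EMul (EMul s t) u)
  | ec_mul1l s : envelope_cong (EMul (EScal 1) s) s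
  | ec_mulDl s t u :
      envelope_cong (EMul (EAdd s t) u) (EAdd (EMul s u) (EMul t u))
  | ec_mulDr s t u :
      envelope_cong (EMul s (EAdd t u)) (EAdd (EMul s t) (EMul s u))
  | ec_scalD a b : envelope_cong (EScal (a + b)) (EAdd (EScal a) (EScal b))
  | ec_scalM a b : envelope_cong (EScal (a * b)) (EMul (EScal a) (EScal b))
  | ec_scalC a s : envelope_cong (EMul (EScal a) s) (EMul s (EScal a))
  | ec_genD x y : envelope_cong (EGen (x + y)) (EAdd (EGen x) (EGen y))
  | ec_genZ a x : envelope_cong (EGen (a *: x)) (EMul (EScal a) (EGen x))
  | ec_bracket x y :
      envelope_cong (EAdd (EGen (bracket x y)) (EMul (EGen y) (EGen x)))
                    (EMul (EGen x) (EGen y)).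

Fixpoint envelope_eval (k : fieldType) (L : lieAlgType k) (A : algType k)
    (f : L -> A) (s : envelope_expr L) : A :=
  match s with
  | EGen x => f x
  | EScal a => a%:A
  | EAdd s t => envelope_eval f s + envelope_eval f t
  | EMul s t => envelope_eval f s * envelope_eval f t
  end.

Lemma envelope_eval_cong (k : fieldType) (L : lieAlgType k) (A : algType k)
    (f : L -> A) (s t : envelope_expr L) :
  is_lie_hom f -> envelope_cong s t -> envelope_eval f s = envelope_eval f t.
Proof.
move=> [linf lief]; elim=> //=.
- by move=> {}s {}t u _ -> _ ->.
- by move=> ? ? ? ? _ -> _ ->.
- by move=> ? ? ? ? _ -> _ ->.
- by move=> *; rewrite addrA.
- by move=> *; rewrite addrC.
- by move=> *; rewrite scale0r add0r.
- by move=> *; rewrite scaleN1r mulN1r addNr scale0r.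
- by move=> *; rewrite mulrA.
- by move=> *; rewrite scale1r mul1r.
- by move=> *; rewrite mulrDl.
- by move=> *; rewrite mulrDr.
- by move=> *; rewrite scalerDl.
- by move=> *; rewrite -scalerAl mul1r scalerA.
- by move=> *; rewrite -scalerAl -scalerAr mul1r mulr1.
- by move=> x y; have := linf 1 x y; rewrite !scale1r.
- move=> a x; have f0 : f 0 = 0.
    have := linf 1 0 0; rewrite !scale1r addr0 => /eqP.
    by rewrite -[X in X == _]addr0 (inj_eq (addrI _)) => /eqP.
  by have := linf a x 0; rewrite f0 !addr0 -scalerAl mul1r.
- by move=> x y; rewrite lief addrNK.
Qed.

Lemma envelope_cong_equiv (k : fieldType) (L : lieAlgType k) :
  equiv_class_of (fun s t : envelope_expr L => `[< envelope_cong s t >]).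
Proof.
split=> [s|s t|t s u].
- by apply/asboolP; apply: ec_refl.
- by apply/asboolP/asboolP; apply: ec_sym.
- by move=> /asboolP st /asboolP tu; apply/asboolP; apply: ec_trans st tu.
Qed.

Canonical envelope_equiv (k : fieldType) (L : lieAlgType k) :=
  EquivRelPack (envelope_cong_equiv L).
Canonical envelope_encModRel (k : fieldType) (L : lieAlgType k) :=
  defaultEncModRel (envelope_equiv L).

Definition envelope (k : fieldType) (L : lieAlgType k) : Type :=
  {eq_quot envelope_equiv L}.

Section EnvelopeAlgebra.

Context (k : fieldType) (L : lieAlgType k).
Local Notation U := (envelope L).
Local Notation E := (envelope_expr L).

HB.instance Definition _ := Choice.on U.
HB.instance Definition _ : EqQuotient E (envelope_equiv L) U :=
  EqQuotient.on U.

Definition envelope_add (u v : U) : U := \pi_U (EAdd (repr u) (repr v)).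
Definition envelope_mul (u v : U) : U := \pi_U (EMul (repr u) (repr v)).
Definition envelope_scal (a : k) : U := \pi_U (EScal a).

Lemma envelope_piP (s t : E) : envelope_cong s t <-> \pi_U s = \pi_U t.
Proof.
split=> [st|/eqmodP/asboolP//].
by apply/eqmodP/asboolP.
Qed.

Lemma envelope_reprP (s : E) : envelope_cong (repr (\pi_U s)) s.
Proof. by apply/envelope_piP; rewrite reprK. Qed.

Lemma envelope_pi_add (s t : E) :
  envelope_add (\pi_U s) (\pi_U t) = \pi_U (EAdd s t).
Proof. by apply/envelope_piP; apply: ec_add; apply: envelope_reprP. Qed.

Lemma envelope_pi_mul (s t : E) :
  envelope_mul (\pi_U s) (\pi_U t) = \pi_U (EMul s t).
Proof. by apply/envelope_piP; apply: ec_mul; apply: envelope_reprP. Qed.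

Lemma envelope_ind (P : U -> Prop) : (forall s, P (\pi_U s)) -> forall u, P u.
Proof. by move=> h u; rewrite -[u]reprK; apply: h. Qed.

Let piE := (envelope_pi_add, envelope_pi_mul).

Let addA : associative envelope_add.
Proof.
elim/envelope_ind=> s; elim/envelope_ind=> t; elim/envelope_ind=> u.
by rewrite !piE; apply/envelope_piP/ec_addA.
Qed.

Let addC : commutative envelope_add.
Proof.
elim/envelope_ind=> s; elim/envelope_ind=> t.
by rewrite !piE; apply/envelope_piP/ec_addC.
Qed.

Let add0 : left_id (envelope_scal 0) envelope_add.
Proof.
by elim/envelope_ind=> s; rewrite !piE; apply/envelope_piP/ec_add0.
Qed.

Let addN : left_inverse (envelope_scal 0) (envelope_mul (envelope_scal (- 1)))
  envelope_add.
Proof.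
elim/envelope_ind=> s; rewrite envelope_pi_mul envelope_pi_add.
exact/envelope_piP/ec_addN.
Qed.

HB.instance Definition _ := GRing.isZmodule.Build U addA addC add0 addN.

Let mulA : associative envelope_mul.
Proof.
elim/envelope_ind=> s; elim/envelope_ind=> t; elim/envelope_ind=> u.
by rewrite !piE; apply/envelope_piP/ec_mulA.
Qed.

Let mul1l : left_id (envelope_scal 1) envelope_mul.
Proof.
by elim/envelope_ind=> s; rewrite !piE; apply/envelope_piP/ec_mul1l.
Qed.

Let scalC (a : k) (u : U) :
  envelope_mul (envelope_scal a) u = envelope_mul u (envelope_scal a).
Proof.
by elim/envelope_ind: u => s; rewrite !piE; apply/envelope_piP/ec_scalC.
Qed.

Let mul1R : right_id (envelope_scal 1) envelope_mul.
Proof. by move=> u; rewrite -scalC mul1l. Qed.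

Let mulDl : left_distributive envelope_mul envelope_add.
Proof.
elim/envelope_ind=> s; elim/envelope_ind=> t; elim/envelope_ind=> u.
rewrite envelope_pi_add !envelope_pi_mul envelope_pi_add.
exact/envelope_piP/ec_mulDl.
Qed.

Let mulDr : right_distributive envelope_mul envelope_add.
Proof.
elim/envelope_ind=> s; elim/envelope_ind=> t; elim/envelope_ind=> u.
rewrite envelope_pi_add !envelope_pi_mul envelope_pi_add.
exact/envelope_piP/ec_mulDr.
Qed.

Lemma zero_is_lie_hom (A : algType k) : is_lie_hom (fun _ : L => 0 : A).
Proof. by split=> [a x y|x y]; rewrite ?scaler0 ?addr0 // mulr0 subrr. Qed.

Let one_neq0 : envelope_scal 1 != 0 :> U.
Proof.
apply/eqP => /envelope_piP /(envelope_eval_cong (zero_is_lie_hom k^o)).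
by rewrite /= scale1r scale0r => /eqP; rewrite oner_eq0.
Qed.

HB.instance Definition _ := GRing.Zmodule_isNzRing.Build U
  mulA mul1l mul1R mulDl mulDr one_neq0.

Let scalM (a b : k) : envelope_scal (a * b) = envelope_scal a * envelope_scal b.
Proof. by rewrite /GRing.mul/= !piE; apply/envelope_piP/ec_scalM. Qed.

Let scalD (a b : k) : envelope_scal (a + b) = envelope_scal a + envelope_scal b.
Proof. by rewrite /GRing.add/= !piE; apply/envelope_piP/ec_scalD. Qed.

Definition envelope_scale (a : k) (u : U) : U := envelope_scal a * u.

Let scaleA (a b : k) (u : U) :
  envelope_scale a (envelope_scale b u) = envelope_scale (a * b) u.
Proof. by rewrite /envelope_scale mulrA scalM. Qed.

Let scale1 : left_id 1 envelope_scale.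
Proof. by move=> u; apply: mul1l. Qed.

Let scaleDr : right_distributive envelope_scale +%R.
Proof. by move=> a u v; rewrite /envelope_scale mulrDr. Qed.

Let scaleDl (u : U) : {morph envelope_scale^~ u : a b / a + b}.
Proof. by move=> a b; rewrite /envelope_scale scalD mulrDl. Qed.

HB.instance Definition _ := GRing.Zmodule_isLmodule.Build k U
  scaleA scale1 scaleDr scaleDl.

Let scaleAl (a : k) (u v : U) : a *: (u * v) = a *: u * v.
Proof. exact: mulrA. Qed.

HB.instance Definition _ := GRing.Lmodule_isLalgebra.Build k U scaleAl.

Let scaleAr (a : k) (u v : U) : a *: (u * v) = u * (a *: v).
Proof.
by rewrite /GRing.scale/= /envelope_scale mulrA [X in X * v]scalC -mulrA.
Qed.

HB.instance Definition _ := GRing.Lalgebra_isAlgebra.Build k U scaleAr.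

Definition envelope_gen (x : L) : U := \pi_U (EGen x).

Lemma envelope_gen_is_lie_hom : is_lie_hom envelope_gen.
Proof.
split=> [a x y|x y].
  transitivity (envelope_gen (a *: x) + envelope_gen y).
    by rewrite [RHS]piE; apply/envelope_piP/ec_genD.
  congr (_ + _); rewrite /GRing.scale/= /envelope_scale [RHS]piE.
  exact/envelope_piP/ec_genZ.
apply/eqP; rewrite eq_sym subr_eq eq_sym; apply/eqP.
rewrite [X in _ + X]piE [LHS]piE [RHS]piE.
exact/envelope_piP/ec_bracket.
Qed.

Section Lift.

Context (A : algType k) (f : L -> A).

Definition envelope_lift (u : U) : A := envelope_eval f (repr u).

Hypothesis f_lie : is_lie_hom f.

Lemma envelope_lift_pi (s : E) : envelope_lift (\pi_U s) = envelope_eval f s.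
Proof. exact/(envelope_eval_cong f_lie)/envelope_reprP. Qed.

Lemma envelope_lift_linear : linear envelope_lift.
Proof.
move=> a; elim/envelope_ind=> s; elim/envelope_ind=> t.
rewrite {1}/GRing.scale/= /envelope_scale [X in X + _]piE [X in envelope_lift X]piE.
by rewrite !envelope_lift_pi /= -scalerAl mul1r.
Qed.

Lemma envelope_lift_monoid_morphism : monoid_morphism envelope_lift.
Proof.
split; first by rewrite envelope_lift_pi /= scale1r.
elim/envelope_ind=> s; elim/envelope_ind=> t.
by rewrite [X in envelope_lift X]piE !envelope_lift_pi.
Qed.

Lemma envelope_lift_gen (x : L) : envelope_lift (envelope_gen x) = f x.
Proof. exact: envelope_lift_pi. Qed.

Lemma envelope_lift_unique (g : {lrmorphism U -> A}) :
  (forall x, g (envelope_gen x) = f x) -> g =1 envelope_lift.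
Proof.
move=> gE; elim/envelope_ind=> s; rewrite envelope_lift_pi.
elim: s => [x|a|s IHs t IHt|s IHs t IHt] /=; first exact: gE.
- have -> : \pi_U (EScal a) = a *: 1.
    by apply/esym; rewrite -[RHS](mulr1 (envelope_scal a)).
  by rewrite linearZ /= rmorph1.
- by rewrite -IHs -IHt -rmorphD; congr (g _); rewrite [RHS]piE.
- by rewrite -IHs -IHt -rmorphM; congr (g _); rewrite [RHS]piE.
Qed.

End Lift.

(* The augmentation U(L) -> k is the algebra morphism killing L. *)
Definition augmentation : U -> k^o := envelope_lift (fun _ : L => 0 : k^o).

HB.instance Definition _ := GRing.isLinear.Build k U k^o _ augmentation
  (envelope_lift_linear (zero_is_lie_hom k^o)).
HB.instance Definition _ := GRing.isMonoidMorphism.Build U k^o augmentation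
  (envelope_lift_monoid_morphism (zero_is_lie_hom k^o)).

End EnvelopeAlgebra.

Definition left_ideal (R : nzRingType) (J : set R) : Prop :=
  [/\ J 0, (forall x y, J x -> J y -> J (x + y)) &
      forall a x, J x -> J (a * x)].

Record two_sided_ideal (R : nzRingType) := TwoSidedIdeal {
  ideal_set :> set R;
  ideal_left : left_ideal ideal_set;
  ideal_right : forall x a, ideal_set x -> ideal_set (x * a)
}.

Fixpoint ideal_pow (R : nzRingType) (I : set R) (n : nat) : set R :=
  if n is n'.+1 then
    [set z | exists (m : nat) (x y : 'I_m -> R),
       (forall i, I (x i) /\ ideal_pow I n' (y i)) /\
       z = \sum_i x i * y i]%classic
  else setT.

(* A grading of R by nat: additive subgroups R_n with R_m R_n contained in
   R_(m+n) and R = R_0 (+) R_1 (+) ... *)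
Record grading (R : nzRingType) := Grading {
  homogeneous :> nat -> set R;
  homogeneous0 : forall n, homogeneous n 0;
  homogeneousB : forall n x y,
    homogeneous n x -> homogeneous n y -> homogeneous n (x - y);
  homogeneous1 : homogeneous 0 1;
  homogeneousM : forall m n x y,
    homogeneous m x -> homogeneous n y -> homogeneous (m + n) (x * y);
  homogeneous_span : forall x, exists (m : nat) (c : 'I_m -> R),
    (forall i : 'I_m, homogeneous i (c i)) /\ x = \sum_i c i;
  homogeneous_free : forall (m : nat) (c : 'I_m -> R),
    (forall i : 'I_m, homogeneous i (c i)) ->
    \sum_i c i = 0 -> forall i, c i = 0
}.

Section Rees.

Context (R : nzRingType) (I : two_sided_ideal R).

Lemma ideal_pow_left n : left_ideal (ideal_pow I n).
Proof.
case: n => [//|n] /=; split.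
- by exists 0%N, (fun=> 0), (fun=> 0); rewrite big_ord0; split=> // -[].
- move=> _ _ [m [x [y [xyI ->]]]] [m' [x' [y' [xyI' ->]]]].
  exists (m + m')%N.
  exists (fun i => match split i with inl j => x j | inr j => x' j end).
  exists (fun i => match split i with inl j => y j | inr j => y' j end).
  split=> [i|]; first by case: (split i).
  rewrite big_split_ord /=; congr (_ + _); apply: eq_bigr => i _.
    by rewrite (unsplitK (inl i)).
  by rewrite (unsplitK (inr i)).
- move=> a _ [m [x [y [xyI ->]]]]; exists m, (fun i => a * x i), y.
  split=> [i|]; last by rewrite mulr_sumr; apply: eq_bigr => i _; rewrite mulrA.
  have [xI yI] := xyI i; split=> //.
  by have [_ _] := ideal_left I; apply.
Qed.

Lemma ideal_pow_sum n m (x : 'I_m -> R) :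
  (forall i, ideal_pow I n (x i)) -> ideal_pow I n (\sum_i x i).
Proof.
by move=> xI; have [I0 ID _] := ideal_pow_left n; apply: big_ind => // i _.
Qed.

Lemma ideal_pow_mul m n x y :
  ideal_pow I m x -> ideal_pow I n y -> ideal_pow I (m + n) (x * y).
Proof.
move=> xI yI; elim: m x xI => [|m IHm] x.
  by move=> _; have [_ _] := ideal_pow_left n; apply.
move=> [p [a [b [abI ->]]]]; rewrite addSn.
exists p, a, (fun i => b i * y); split=> [i|]; last first.
  by rewrite mulr_suml; apply: eq_bigr => i _; rewrite mulrA.
by have [aI bI] := abI i; split=> //; apply: IHm.
Qed.

(* An element of the direct sum of the I^n is a finitely supported sequence
   whose n-th term lies in I^n, i.e. a polynomial over R whose n-th coefficient
   lies in I^n; the product of polynomials is the one induced by the products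
   I^m x I^n -> I^(m+n). *)
Definition rees_pred : {pred {poly R}} :=
  fun p => `[< forall n, ideal_pow I n p`_n >].

Lemma rees_predP (p : {poly R}) :
  reflect (forall n, ideal_pow I n p`_n) (p \in rees_pred).
Proof. exact: asboolP. Qed.

Lemma rees_subring_closed : subring_closed rees_pred.
Proof.
split=> [|p q /rees_predP pI /rees_predP qI|p q /rees_predP pI /rees_predP qI];
  apply/rees_predP=> n.
- rewrite coef1; case: n => [//|n]; by have [] := ideal_pow_left n.+1.
- rewrite coefB; have [_ ID IM] := ideal_pow_left n.
  by apply: ID => //; rewrite -mulN1r; apply: IM.
- rewrite coefM; apply: ideal_pow_sum => i.
  by rewrite -[n in ideal_pow I n](subnKC (leq_ord i)); apply: ideal_pow_mul.
Qed.

HB.instance Definition _ := GRing.isSubringClosed.Build {poly R} rees_pred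
  rees_subring_closed.

Record rees := Rees { rees_val :> {poly R}; _ : rees_val \in rees_pred }.

HB.instance Definition _ := [isSub for rees_val].
HB.instance Definition _ := [Choice of rees by <:].
HB.instance Definition _ := [SubChoice_isSubNzRing of rees by <:].

(* The copy of I^n sitting in degree n of the Rees algebra. *)
Definition rees_homogeneous (n : nat) : set rees :=
  [set p | forall i, i != n -> (rees_val p)`_i = 0]%classic.

Lemma rees_val_sum m (c : 'I_m -> rees) :
  rees_val (\sum_i c i) = \sum_i rees_val (c i).
Proof. exact: (raddf_sum (val : rees -> {poly R})). Qed.

Lemma rees_homogeneous0 n : rees_homogeneous n 0.
Proof.
move=> i _; have -> : rees_val 0 = 0 by exact: (raddf0 (val : rees -> {poly R})).
exact: coef0.
Qed.

Lemma rees_homogeneousB n x y : rees_homogeneous n x ->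
  rees_homogeneous n y -> rees_homogeneous n (x - y).
Proof.
move=> xn yn i ni; have -> : rees_val (x - y) = rees_val x - rees_val y.
  exact: (raddfB (val : rees -> {poly R})).
by rewrite coefB xn // yn // subrr.
Qed.

Lemma rees_homogeneous1 : rees_homogeneous 0 1.
Proof.
move=> i; have -> : rees_val 1 = 1 by exact: (rmorph1 (val : rees -> {poly R})).
by rewrite coef1 => /negPf->.
Qed.

Lemma rees_homogeneousM m n x y : rees_homogeneous m x ->
  rees_homogeneous n y -> rees_homogeneous (m + n) (x * y).
Proof.
move=> xm yn i; have -> : rees_val (x * y) = rees_val x * rees_val y.
  exact: (rmorphM (val : rees -> {poly R})).
move=> imn; rewrite coefM big1 // => j _.
have [jm|jm] := eqVneq (j : nat) m; last by rewrite xm // mul0r.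
rewrite (yn (i - j)%N) ?mulr0 //; apply: contra imn => /eqP <-.
by rewrite -jm subnKC ?leq_ord.
Qed.

Lemma rees_homogeneous_span x : exists (m : nat) (c : 'I_m -> rees),
  (forall i : 'I_m, rees_homogeneous i (c i)) /\ x = \sum_i c i.
Proof.
have cP (n : nat) : (rees_val x)`_n *: 'X^n \in rees_pred.
  apply/rees_predP=> i; rewrite coefZ coefXn; case: eqP => [->|_].
    by rewrite mulr1; case: x => p /= /rees_predP.
  by rewrite mulr0; have [] := ideal_pow_left i.
exists (size (rees_val x)), (fun i => Rees (cP i)); split=> [i j ji|].
  by rewrite /= coefZ coefXn (negPf ji) mulr0.
apply: (val_inj : injective rees_val).
by rewrite rees_val_sum /= -poly_def coefK.
Qed.

Lemma rees_homogeneous_free m (c : 'I_m -> rees) :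
  (forall i : 'I_m, rees_homogeneous i (c i)) ->
  \sum_i c i = 0 -> forall i, c i = 0.
Proof.
move=> cG c0 i; apply: (val_inj : injective rees_val).
have -> : \val (0 : rees) = 0 by exact: (raddf0 (val : rees -> {poly R})).
apply/polyP=> n; rewrite coef0 /=.
have [->|ni] := eqVneq n i; last exact: cG.
have /(congr1 (fun p : rees => (rees_val p)`_i)) := c0.
rewrite rees_val_sum coef_sum (bigD1 i) //= big1 => [|j ji].
  rewrite addr0 => ->; exact: coef0.
by apply: cG; rewrite eq_sym.
Qed.

Definition rees_grading : grading rees :=
  Grading rees_homogeneous0 rees_homogeneousB rees_homogeneous1 rees_homogeneousM
    rees_homogeneous_span rees_homogeneous_free.

End Rees.

Definition finitely_generated_left (R : nzRingType) (J : set R) : Prop :=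
  exists (n : nat) (g : 'I_n -> R),
    forall x, J x <-> exists c : 'I_n -> R, x = \sum_i c i * g i.

(* A left ideal is graded when it is the sum of its intersections with the
   homogeneous components. *)
Definition graded_left_ideal (R : nzRingType) (G : grading R) (J : set R) : Prop :=
  left_ideal J /\
  forall x, J x -> exists (m : nat) (c : 'I_m -> R),
    (forall i : 'I_m, G i (c i) /\ J (c i)) /\ x = \sum_i c i.

Definition graded_left_noetherian (R : nzRingType) (G : grading R) : Prop :=
  forall J : set R, graded_left_ideal G J -> finitely_generated_left J.

Section AugmentationIdeal.

Context (k : fieldType) (L : lieAlgType k).

Definition augmentation_kernel : set (envelope L) :=
  [set u | augmentation u = 0]%classic.

Lemma augmentation_kernel_left : left_ideal augmentation_kernel.
Proof.
split=> [|x y|a x]; rewrite /augmentation_kernel/=; first exact: raddf0.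
  by move=> x0 y0; rewrite raddfD /= x0 y0 addr0.
by move=> x0; rewrite rmorphM /= x0 mulr0.
Qed.

Lemma augmentation_kernel_right x a :
  augmentation_kernel x -> augmentation_kernel (x * a).
Proof. by rewrite /augmentation_kernel/= rmorphM /= => ->; rewrite mul0r. Qed.

Definition augmentation_ideal : two_sided_ideal (envelope L) :=
  TwoSidedIdeal augmentation_kernel_left augmentation_kernel_right.

End AugmentationIdeal.

Arguments augmentation_ideal {k} L.

(* Main.v *)
From HB Require Import structures.
Require Import Defs.
From mathcomp Require Import all_boot all_algebra.
From mathcomp Require Import boolp classical_sets.
From mathcomp Require Import mpoly.

Set Implicit Arguments.
Unset Strict Implicit.
Unset Printing Implicit Defensive.

Import GRing.Theory.

Local Open Scope ring_scope.

(** Write U for the enveloping algebra of L, I for its augmentation ideal, and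
    view the Rees algebra as the subring of the polynomial ring U[X] whose n-th
    coefficients lie in I^n.

    Suppose that L is nilpotent, and let L_n be the n-th term of its lower
    central series, with L_0 = L. An element of L_n is a combination of n-fold
    commutators, so it lies in I^(n+1), and the Rees algebra contains the
    elements x X^j with x in L_n and j <= n + 1. For n = 0 these already
    generate it, because I is generated by L as a left ideal. The commutator of
    an element of level m with an element of level n is again such an element,
    of level m + n + 1, since [L_m, L_n] is contained in L_(m+n+1). Nilpotency
    leaves finitely many levels, so a list of generators ordered by decreasing
    level builds the Rees algebra from the scalars by adjoining one element at a
    time, whose commutators with the subring generated before it stay in that
    subring. Hilbert's basis theorem holds for such skew extensions
    ([ore_ext_noetherian]), even when the powers of the new element satisfy
    relations; so no basis of U is ever needed, and every left ideal is finitely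
    generated ([nilpotent_rees_noetherian]).

    Conversely, suppose that the Rees algebra is graded left Noetherian, and let
    x in L lie in every I^n. The graded left ideal of the p with all
    coefficients in U x is finitely generated; comparing coefficients of x X^d
    for d beyond the degrees of the generators gives x = a x with a in I
    ([noetherian_fixed_point]). The lower central series is eventually constant,
    and all elements x of its stable term lie in every I^n. By
    [no_left_fixed_point], x = a x forces x to be central, so the stable term W
    equals [L, W] = 0, and L is nilpotent.

    The lemma [no_left_fixed_point] would follow from the
    Poincare-Birkhoff-Witt theorem, as U is then a domain. It is obtained here
    from explicit representations, valid in every characteristic. Let S be the
    symmetric algebra of L, on which x in L acts by the derivation d_x extending
    the adjoint action. Fix g in L, and let x act on S[t] by d_x + t [x, g],
    which is formally the conjugate of d_x by exp(t g). If [x, g] <> 0 and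
    u = 1 - a kills x on the left, the leading coefficient in t of the operator
    of u is a differential operator on S killing the ideal generated by [x, g];
    since S is a domain, that operator vanishes ([diffop_mulop_eq0]). So u acts
    as 0. But the constant term of u applied to 1 is the augmentation of u,
    which is 1. *)

(** * Hilbert's basis theorem for skew extensions *)

Section SubringNoetherian.

Context (A : nzRingType).

Record subring_set (B : set A) : Prop := SubringSet {
  subring_set1 : B 1;
  subring_setB : forall x y, B x -> B y -> B (x - y);
  subring_setM : forall x y, B x -> B y -> B (x * y)
}.

Section SubringTheory.

Context (B : set A) (Bring : subring_set B).

Lemma subring_set0 : B 0.
Proof.
by rewrite -(subrr 1); apply: subring_setB => //; apply: subring_set1.
Qed.

Lemma subring_setN x : B x -> B (- x).
Proof.
by move=> Bx; rewrite -sub0r; apply: subring_setB => //; apply: subring_set0.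
Qed.

Lemma subring_setD x y : B x -> B y -> B (x + y).
Proof.
move=> Bx By; rewrite -[y]opprK.
by apply: subring_setB => //; apply: subring_setN.
Qed.

Lemma subring_setX x n : B x -> B (x ^+ n).
Proof.
move=> Bx; elim: n => [|n IHn]; first exact: subring_set1.
by rewrite exprS; apply: subring_setM.
Qed.

Lemma subring_set_sum (I : Type) (r : seq I) (P : pred I) (F : I -> A) :
  (forall i, P i -> B (F i)) -> B (\sum_(i <- r | P i) F i).
Proof.
move=> BF; apply: (big_ind B) => //; first exact: subring_set0.
exact: subring_setD.
Qed.

End SubringTheory.

(** Left ideals of a subring are kept as subsets of the ambient ring: the basis
    theorem below climbs a tower of subrings, all of which live in one ring. *)
Record left_ideal_in (B J : set A) : Prop := LeftIdealIn {
  left_ideal_in_sub : forall x, J x -> B x;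
  left_ideal_in0 : J 0;
  left_ideal_inD : forall x y, J x -> J y -> J (x + y);
  left_ideal_inM : forall b x, B b -> J x -> J (b * x)
}.

(** The inductive form lets a property of the generators that is stable under
    left combinations be proved by induction; [left_spanE] recovers the
    coefficients. *)
Inductive left_span (B : set A) (G : seq A) : A -> Prop :=
  | left_span0 : left_span B G 0
  | left_span_gen g : g \in G -> left_span B G g
  | left_spanD x y : left_span B G x -> left_span B G y -> left_span B G (x + y)
  | left_spanM b x : B b -> left_span B G x -> left_span B G (b * x).

Definition left_noetherian_in (B : set A) : Prop :=
  forall J, left_ideal_in B J ->
  exists2 G : seq A, (forall g, g \in G -> J g) &
    forall x, J x -> left_span B G x.

Lemma left_span_subideal B J G : left_ideal_in B J ->
  (forall g, g \in G -> J g) -> forall x, left_span B G x -> J x.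
Proof.
move=> Jid GJ x; elim=> {x}.
- exact: left_ideal_in0 Jid.
- exact: GJ.
- by move=> x y _ Jx _ Jy; apply: (left_ideal_inD Jid).
- by move=> b x Bb _ Jx; apply: (left_ideal_inM Jid).
Qed.

Lemma left_span_mono B G G' : {subset G <= G'} ->
  forall x, left_span B G x -> left_span B G' x.
Proof.
move=> GG' x; elim=> {x}.
- exact: left_span0.
- by move=> g /GG' g'; apply: left_span_gen.
- by move=> x y _ Jx _ Jy; apply: left_spanD.
- by move=> b x Bb _ Jx; apply: left_spanM.
Qed.

Lemma left_spanE B G x : subring_set B -> left_span B G x ->
  exists2 c : 'I_(size G) -> A, (forall i, B (c i)) &
    x = \sum_i c i * G`_i.
Proof.
move=> Bring; elim=> {x}.
- exists (fun=> 0) => [_|]; first exact: subring_set0.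
  by rewrite big1 // => i _; rewrite mul0r.
- move=> g gG; have gi : (index g G < size G)%N by rewrite index_mem.
  exists (fun i => (i == Ordinal gi)%:R) => [i|].
    by case: (_ == _); [apply: subring_set1|apply: subring_set0].
  rewrite (bigD1 (Ordinal gi)) //= eqxx mul1r nth_index // big1 ?addr0 //.
  by move=> i /negPf->; rewrite mul0r.
- move=> x y _ [c cB ->] _ [d dB ->]; exists (fun i => c i + d i) => [i|].
    exact: subring_setD.
  by rewrite -big_split; apply: eq_bigr => i _; rewrite mulrDl.
- move=> b x Bb _ [c cB ->]; exists (fun i => b * c i) => [i|].
    exact: subring_setM.
  by rewrite mulr_sumr; apply: eq_bigr => i _; rewrite mulrA.
Qed.

Lemma seq_choice (T S : eqType) (s : seq T) (P : T -> S -> Prop) :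
  (forall x, x \in s -> exists y, P x y) ->
  exists2 r : seq S, (forall y, y \in r -> exists2 x, x \in s & P x y) &
    (forall x, x \in s -> exists2 y, y \in r & P x y).
Proof.
elim: s => [|a s IHs] sP; first by exists [::].
have [y Pay] := sP a (mem_head _ _).
have [x xs|r r1 r2] := IHs; first by apply: sP; rewrite inE xs orbT.
exists (y :: r) => [z|x]; rewrite inE => /predU1P[->|].
- by exists a => //; apply: mem_head.
- by move/r1 => [x xs Px]; exists x => //; rewrite inE xs orbT.
- by exists y => //; apply: mem_head.
- by move/r2 => [z zr Px]; exists z => //; rewrite inE zr orbT.
Qed.

Lemma seq_bound (T : eqType) (s : seq T) (P : T -> nat -> Prop) :
  (forall x, x \in s -> exists n, P x n) ->
  (forall x m n, (m <= n)%N -> P x m -> P x n) ->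
  exists n, forall x, x \in s -> P x n.
Proof.
move=> sP monoP; elim: s sP => [|a s IHs] sP; first by exists 0%N.
have [m Pam] := sP a (mem_head _ _).
have [x xs|n nP] := IHs; first by apply: sP; rewrite inE xs orbT.
exists (maxn m n) => x; rewrite inE => /predU1P[->|xs].
  by apply: monoP Pam; apply: leq_maxl.
by apply: monoP (nP x xs); apply: leq_maxr.
Qed.

Section OreExtension.

Context (B : set A) (x : A) (Bring : subring_set B).
Hypothesis Bcomm : forall b, B b -> B (x * b - b * x).
Hypothesis Bnoeth : left_noetherian_in B.

(** The sums of b_i x^i with i < n and all b_i in B, described by peeling off
    the top term. The powers of x need not be independent over B, so an element
    may have several top coefficients. *)
Fixpoint ore_lt (n : nat) : set A :=
  if n is n'.+1 then
    [set z | exists2 b, B b & ore_lt n' (z - b * x ^+ n')]%classic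
  else [set 0]%classic.

Definition ore_ext : set A := [set z | exists n, ore_lt n z]%classic.

Lemma ore_lt0 n : ore_lt n 0.
Proof.
elim: n => [//|n IHn]; exists 0; first exact: subring_set0.
by rewrite mul0r subr0.
Qed.

Lemma ore_ltD n y z : ore_lt n y -> ore_lt n z -> ore_lt n (y + z).
Proof.
elim: n y z => [|n IHn] y z /=; first by move=> -> ->; rewrite addr0.
move=> [b Bb yb] [c Bc zc]; exists (b + c); first exact: subring_setD.
by rewrite mulrDl opprD addrACA; apply: IHn.
Qed.

Lemma ore_ltM n b y : B b -> ore_lt n y -> ore_lt n (b * y).
Proof.
move=> Bb; elim: n y => [|n IHn] y /=; first by move=> ->; rewrite mulr0.
move=> [c Bc yc]; exists (b * c); first exact: subring_setM.
by rewrite -mulrA -mulrBr; apply: IHn.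
Qed.

Lemma ore_ltN n y : ore_lt n y -> ore_lt n (- y).
Proof.
move=> yn; rewrite -mulN1r; apply: ore_ltM => //.
by apply: subring_setN => //; apply: subring_set1.
Qed.

Lemma ore_ltB n y z : ore_lt n y -> ore_lt n z -> ore_lt n (y - z).
Proof. by move=> yn zn; apply: ore_ltD => //; apply: ore_ltN. Qed.

Lemma ore_ltS n y : ore_lt n y -> ore_lt n.+1 y.
Proof. by move=> yn; exists 0; [apply: subring_set0|rewrite mul0r subr0]. Qed.

Lemma ore_lt_mono m n y : (m <= n)%N -> ore_lt m y -> ore_lt n y.
Proof.
move=> /subnK <-; elim: (n - m)%N => [//|d IHd] ym.
by rewrite addSn; apply/ore_ltS/IHd.
Qed.

Lemma ore_lt_monom n b : B b -> ore_lt n.+1 (b * x ^+ n).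
Proof. by move=> Bb; exists b => //; rewrite subrr; apply: ore_lt0. Qed.

(** Moving x past a coefficient b costs the commutator of x and b, which stays
    in B and multiplies a power of x one lower. *)
Lemma ore_lt_mulx n y : ore_lt n y -> ore_lt n.+1 (x * y).
Proof.
elim: n y => [|n IHn] y.
  by move=> ->; rewrite mulr0; apply: ore_lt0.
move=> [b Bb yb].
have -> : x * y = b * x ^+ n.+1 + (x * b - b * x) * x ^+ n
    + x * (y - b * x ^+ n).
  by rewrite mulrBl mulrBr exprS !mulrA [b * x * _ + _]addrC subrK addrC subrK.
apply: ore_ltD; last by apply: ore_ltS; apply: IHn.
apply: ore_ltD; first exact: ore_lt_monom.
by apply: ore_ltS; apply: ore_lt_monom; apply: Bcomm.
Qed.

Lemma ore_lt_mulxn m n y : ore_lt n y -> ore_lt (m + n) (x ^+ m * y).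
Proof.
move=> yn; elim: m => [|m IHm]; first by rewrite mul1r.
by rewrite exprS -mulrA addSn; apply: ore_lt_mulx.
Qed.

(** Multiplication by x on the left keeps leading coefficients: the commutators
    that arise only affect lower terms. *)
Lemma ore_lt_leadM m n b y : B b -> ore_lt n (y - b * x ^+ n) ->
  ore_lt (m + n) (x ^+ m * y - b * x ^+ (m + n)).
Proof.
move=> Bb; elim: m => [|m IHm] yb; first by rewrite mul1r.
have -> : x ^+ m.+1 * y - b * x ^+ (m.+1 + n) =
    x * (x ^+ m * y - b * x ^+ (m + n)) + (x * b - b * x) * x ^+ (m + n).
  by rewrite mulrBr mulrBl addSn !exprS !mulrA addrA subrK.
rewrite addSn; apply: ore_ltD; first by apply/ore_lt_mulx/IHm.
by apply: ore_lt_monom; apply: Bcomm.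
Qed.

Lemma ore_extM y z : ore_ext y -> ore_ext z -> ore_ext (y * z).
Proof.
move=> [m ym] [n zn]; elim: m y ym => [|m IHm] y.
  by move=> ->; rewrite mul0r; exists 0%N.
move=> [b Bb yb]; have [p yp] := IHm _ yb.
exists (maxn p (m + n)); rewrite -[y](subrK (b * x ^+ m)) mulrDl.
apply: ore_ltD; first by apply: ore_lt_mono yp; apply: leq_maxl.
rewrite -mulrA; apply: ore_ltM => //.
by apply: ore_lt_mono (ore_lt_mulxn m zn); apply: leq_maxr.
Qed.

Lemma ore_ext_base b : B b -> ore_ext b.
Proof.
by move=> Bb; exists 1%N; rewrite -[b]mulr1; apply: (@ore_lt_monom 0).
Qed.

Lemma ore_ext_var : ore_ext x.
Proof.
exists 2%N; rewrite -[x]mul1r; apply: (@ore_lt_monom 1).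
exact: subring_set1.
Qed.

Lemma ore_ext_subring : subring_set ore_ext.
Proof.
split; first by apply: ore_ext_base; apply: subring_set1.
- move=> y z [m ym] [n zn]; exists (maxn m n); apply: ore_ltB.
    by apply: ore_lt_mono ym; apply: leq_maxl.
  by apply: ore_lt_mono zn; apply: leq_maxr.
- exact: ore_extM.
Qed.

Section Basis.

Context (J : set A) (Jid : left_ideal_in ore_ext J).

Definition lead_ideal (n : nat) : set A :=
  [set b | B b /\ exists2 y, J y & ore_lt n (y - b * x ^+ n)]%classic.

Lemma lead_ideal_ideal n : left_ideal_in B (lead_ideal n).
Proof.
split.
- by move=> b [].
- split; first exact: subring_set0.
  exists 0; first exact: left_ideal_in0 Jid.
  by rewrite mul0r subrr; apply: ore_lt0.
- move=> b c [Bb [y Jy yb]] [Bc [z Jz zc]]; split; first exact: subring_setD.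
  exists (y + z); first exact: left_ideal_inD Jid _ _ Jy Jz.
  by rewrite mulrDl opprD addrACA; apply: ore_ltD.
- move=> c b Bc [Bb [y Jy yb]]; split; first exact: subring_setM.
  exists (c * y).
    by apply: left_ideal_inM Jid _ _ _ Jy; apply: ore_ext_base.
  by rewrite -mulrA -mulrBr; apply: ore_ltM.
Qed.

Lemma lead_ideal_mono m n b : (m <= n)%N -> lead_ideal m b -> lead_ideal n b.
Proof.
move=> /subnK <- [Bb [y Jy yb]]; split=> //.
exists (x ^+ (n - m) * y); last exact: ore_lt_leadM.
apply: left_ideal_inM Jid _ _ _ Jy.
by apply: (subring_setX ore_ext_subring); apply: ore_ext_var.
Qed.

Lemma lead_ideal_union_ideal :
  left_ideal_in B [set b | exists n, lead_ideal n b]%classic.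
Proof.
split.
- by move=> b [n [Bb _]].
- by exists 0%N; apply: left_ideal_in0 (lead_ideal_ideal 0).
- move=> b c [m bm] [n cn]; exists (maxn m n).
  apply: (left_ideal_inD (lead_ideal_ideal _)).
    by apply: lead_ideal_mono bm; apply: leq_maxl.
  by apply: lead_ideal_mono cn; apply: leq_maxr.
- move=> c b Bc [n bn]; exists n.
  exact: left_ideal_inM (lead_ideal_ideal n) _ _ Bc bn.
Qed.

(** Since a leading coefficient determines an element only up to lower terms, G
    generates J as soon as it accounts for the leading coefficients in every
    degree. *)
Definition covers_degree (G : seq A) (n : nat) : Prop :=
  forall b, lead_ideal n b ->
  exists2 y, left_span ore_ext G y & ore_lt n (y - b * x ^+ n).

Lemma covers_degree_mono G G' n : {subset G <= G'} ->
  covers_degree G n -> covers_degree G' n.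
Proof.
move=> GG' Gn b /Gn [y Gy yb]; exists y => //.
exact: left_span_mono Gy.
Qed.

Lemma covers_degree_span G Bs n :
  (forall b, b \in Bs ->
    exists2 y, left_span ore_ext G y & ore_lt n (y - b * x ^+ n)) ->
  (forall b, lead_ideal n b -> left_span B Bs b) ->
  covers_degree G n.
Proof.
move=> BsG nBs b /nBs; elim=> {b}.
- exists 0; first exact: left_span0.
  by rewrite mul0r subrr; apply: ore_lt0.
- exact: BsG.
- move=> b c _ [y Gy yb] _ [z Gz zc]; exists (y + z); first exact: left_spanD.
  by rewrite mulrDl opprD addrACA; apply: ore_ltD.
- move=> c b Bc _ [y Gy yb]; exists (c * y).
    by apply: left_spanM => //; apply: ore_ext_base.
  by rewrite -mulrA -mulrBr; apply: ore_ltM.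
Qed.

Lemma covers_one_degree n :
  exists2 G : seq A, (forall g, g \in G -> J g) & covers_degree G n.
Proof.
have [Bs BsJ nBs] := Bnoeth (lead_ideal_ideal n).
have [b bBs|G GJ BsG] := @seq_choice _ _ Bs
    (fun b y => J y /\ ore_lt n (y - b * x ^+ n)).
  by have [_ [y Jy yb]] := BsJ b bBs; exists y.
exists G => [g /GJ[b _ []] //|].
apply: covers_degree_span nBs => b /BsG [y yG [_ yb]].
by exists y => //; apply: left_span_gen.
Qed.

(** The ideals of leading coefficients increase with the degree. Finitely many
    elements generate their union, all of them already occur in a common degree
    N, and their multiples by powers of x serve every degree n >= N. *)
Lemma covers_large_degrees :
  exists N, exists2 G : seq A, (forall g, g \in G -> J g) &
    forall n, (N <= n)%N -> covers_degree G n.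
Proof.
have [Bs BsJ nBs] := Bnoeth lead_ideal_union_ideal.
have [b bBs|b m n mn bm|N NP] := @seq_bound _ Bs (fun b n => lead_ideal n b).
- exact: BsJ.
- exact: lead_ideal_mono bm.
have [b bBs|G GJ BsG] := @seq_choice _ _ Bs
    (fun b y => [/\ B b, J y & ore_lt N (y - b * x ^+ N)]).
  by have [Bb [y Jy yb]] := NP b bBs; exists y.
exists N, G => [g /GJ[b _ []] //|n Nn].
apply: (@covers_degree_span _ Bs) => [b /BsG [y yG [Bb _ yb]]|b bn]; last first.
  by apply: nBs; exists n.
exists (x ^+ (n - N) * y).
  apply: left_spanM; last exact: left_span_gen.
  by apply: (subring_setX ore_ext_subring); apply: ore_ext_var.
by rewrite -(subnK Nn) addnK; apply: ore_lt_leadM.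
Qed.

Lemma covers_all_degrees :
  exists2 G : seq A, (forall g, g \in G -> J g) & forall n, covers_degree G n.
Proof.
have [N] := covers_large_degrees.
elim: N => [|N IHN] [G GJ GP]; first by exists G => // n; apply: GP.
have [G' GJ' GP'] := covers_one_degree N.
apply: IHN; exists (G' ++ G) => [g|n].
  by rewrite mem_cat => /orP[/GJ'|/GJ].
rewrite leq_eqVlt => /predU1P[<-|Nn].
  by apply: covers_degree_mono GP' => g gG; rewrite mem_cat gG.
by apply: covers_degree_mono (GP n Nn) => g gG; rewrite mem_cat gG orbT.
Qed.

Lemma ore_ideal_fg :
  exists2 G : seq A, (forall g, g \in G -> J g) &
    forall y, J y -> left_span ore_ext G y.
Proof.
have [G GJ GP] := covers_all_degrees; exists G => // y Jy.
have [n yn] := left_ideal_in_sub Jid Jy.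
elim: n y yn Jy => [|n IHn] y; first by move=> -> _; apply: left_span0.
move=> [b Bb yb] Jy.
have [|z Gz zb] := GP n b; first by split=> //; exists y.
have Jz := left_span_subideal Jid GJ Gz.
rewrite -[y](subrK z); apply: left_spanD => //; apply: IHn.
  have -> : y - z = y - b * x ^+ n - (z - b * x ^+ n).
    by rewrite opprB addrA subrK.
  exact: ore_ltB.
apply: (left_ideal_inD Jid) => //; rewrite -mulN1r.
apply: (left_ideal_inM Jid) => //.
exact: (subring_setN ore_ext_subring (subring_set1 ore_ext_subring)).
Qed.

End Basis.

(** Hilbert's argument: generators for the leading coefficients of large degree,
    together with generators for each of the finitely many remaining degrees,
    generate J, by descent on the degree. *)
Theorem ore_ext_noetherian : left_noetherian_in ore_ext.
Proof. exact: ore_ideal_fg. Qed.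

End OreExtension.

Inductive subring_gen (K : set A) (xs : seq A) : A -> Prop :=
  | subring_gen_base a : K a -> subring_gen K xs a
  | subring_gen_mem y : y \in xs -> subring_gen K xs y
  | subring_genB y z :
      subring_gen K xs y -> subring_gen K xs z -> subring_gen K xs (y - z)
  | subring_genM y z :
      subring_gen K xs y -> subring_gen K xs z -> subring_gen K xs (y * z).

Section Tower.

Context (K : set A) (Kring : subring_set K).
Hypothesis Kcentral : forall a y, K a -> y * a = a * y.
Hypothesis Knoeth : left_noetherian_in K.

Lemma subring_gen_subring xs : subring_set (subring_gen K xs).
Proof.
split; [|exact: subring_genB|exact: subring_genM].
by apply: subring_gen_base; apply: subring_set1.
Qed.

Lemma subring_gen_min xs B : subring_set B -> (forall a, K a -> B a) ->
  (forall y, y \in xs -> B y) -> forall z, subring_gen K xs z -> B z.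
Proof.
move=> Bring KB xsB z; elim=> {z} //.
- by move=> y z _ By _ Bz; apply: subring_setB.
- by move=> y z _ By _ Bz; apply: subring_setM.
Qed.

Lemma subring_gen_mono xs ys : {subset xs <= ys} ->
  forall z, subring_gen K xs z -> subring_gen K ys z.
Proof.
move=> xys; apply: subring_gen_min; first exact: subring_gen_subring.
  exact: subring_gen_base.
by move=> y /xys; apply: subring_gen_mem.
Qed.

(** Commutation with x is a derivation, so it is enough to control it on
    generators. *)
Lemma subring_gen_comm xs x :
  (forall y, y \in xs -> subring_gen K xs (x * y - y * x)) ->
  forall z, subring_gen K xs z -> subring_gen K xs (x * z - z * x).
Proof.
have gring := subring_gen_subring xs.
move=> xsP z; elim=> {z} //.
- by move=> a Ka; rewrite Kcentral // subrr; apply: subring_set0.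
- move=> y z _ yP _ zP.
  have -> : x * (y - z) - (y - z) * x = (x * y - y * x) - (x * z - z * x).
    by rewrite mulrBr mulrBl !opprB addrACA [RHS]addrACA (addrC (- _)).
  exact: subring_setB.
- move=> y z yg yP zg zP.
  have -> : x * (y * z) - y * z * x
      = (x * y - y * x) * z + y * (x * z - z * x).
    by rewrite mulrBl mulrBr !mulrA addrA subrK.
  by apply: subring_setD => //; apply: subring_setM.
Qed.

Lemma left_noetherian_in_eq (B C : set A) : (forall z, B z <-> C z) ->
  left_noetherian_in B -> left_noetherian_in C.
Proof.
move=> BC; suff -> : B = C by [].
by apply/funext => z; apply/propext.
Qed.

Lemma subring_gen_cons_noetherian xs x :
  left_noetherian_in (subring_gen K xs) ->
  (forall y, y \in xs -> subring_gen K xs (x * y - y * x)) ->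
  left_noetherian_in (subring_gen K (x :: xs)).
Proof.
move=> xsN /subring_gen_comm xsP.
have gring := subring_gen_subring xs.
have gring' := subring_gen_subring (x :: xs).
apply: left_noetherian_in_eq (ore_ext_noetherian gring xsP xsN) => z.
split=> [[n]|]; last first.
  apply: subring_gen_min; first exact: ore_ext_subring.
    by move=> a Ka; apply/ore_ext_base => //; apply: subring_gen_base.
  move=> y; rewrite inE => /predU1P[->|yxs]; first exact: ore_ext_var.
  by apply/ore_ext_base => //; apply: subring_gen_mem.
elim: n z => [|n IHn] z; first by move=> ->; apply: subring_set0.
move=> [b bP /IHn zb]; rewrite -[z](subrK (b * x ^+ n)).
apply: subring_setD => //; apply: subring_setM => //.
  by apply: subring_gen_mono bP => y yxs; rewrite inE yxs orbT.
by apply: subring_setX => //; apply: subring_gen_mem; apply: mem_head.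
Qed.

(** Adjoining the elements of xs one at a time is legitimate because their
    commutators fall in the subring generated by ys, which is present from the
    start. *)
Lemma subring_gen_cat_noetherian xs ys :
  left_noetherian_in (subring_gen K ys) ->
  (forall x y, x \in xs -> y \in xs ++ ys ->
    subring_gen K ys (x * y - y * x)) ->
  left_noetherian_in (subring_gen K (xs ++ ys)).
Proof.
move=> ysN; elim: xs => [//|x xs IHxs] xsP /=.
apply: subring_gen_cons_noetherian.
  apply: IHxs => y z yxs zxs; apply: xsP; first by rewrite inE yxs orbT.
  by rewrite /= inE zxs orbT.
move=> y yxs; apply: (@subring_gen_mono ys).
  by move=> z zys; rewrite mem_cat zys orbT.
by apply: xsP; rewrite ?mem_head //= inE yxs orbT.
Qed.

Lemma subring_gen_nil_noetherian : left_noetherian_in (subring_gen K [::]).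
Proof.
apply: left_noetherian_in_eq Knoeth => z; split; first exact: subring_gen_base.
exact: subring_gen_min.
Qed.

End Tower.

End SubringNoetherian.

(** * Lie algebras and the lower central series *)

Section LieAlgebra.

Context (k : fieldType) (L : lieAlgType k).
Implicit Types x y z : L.

HB.instance Definition _ x :=
  GRing.isLinear.Build k L L _ (bracket x) (linear_bracketr x).

Lemma bracketC x y : bracket x y = - bracket y x.
Proof.
apply/eqP; rewrite -addr_eq0.
have D a b c : bracket (a + b) c = bracket a c + bracket b c.
  by have := linear_bracketl c 1 a b; rewrite !scale1r.
have := bracketxx (x + y).
by rewrite D !linearD /= !bracketxx addr0 add0r => ->.
Qed.

Lemma bracket_jacobi x y z :
  bracket (bracket x y) z = bracket x (bracket y z) - bracket y (bracket x z).
Proof.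
have := jacobi x y z.
rewrite -addrA => /eqP; rewrite addr_eq0 => /eqP ->.
rewrite (bracketC z x) linearN opprD opprK addrAC.
by rewrite subrr add0r bracketC.
Qed.

Lemma lower_central_linear n a x y :
  lower_central L n x -> lower_central L n y -> lower_central L n (a *: x + y).
Proof.
case: n => [//|n] [m [c [u [v [vn ->]]]]] [m' [c' [u' [v' [vn' ->]]]]].
exists (m + m')%N.
exists (fun i => match split i with inl j => a * c j | inr j => c' j end).
exists (fun i => match split i with inl j => u j | inr j => u' j end).
exists (fun i => match split i with inl j => v j | inr j => v' j end).
split=> [i|]; first by case: (split i).
rewrite big_split_ord /= scaler_sumr; congr (_ + _); apply: eq_bigr => i _.
  by rewrite (unsplitK (inl i)) scalerA.
by rewrite (unsplitK (inr i)).
Qed.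

Lemma lower_central0 n : lower_central L n 0.
Proof.
case: n => [//|n]; exists 0%N, (fun=> 0), (fun=> 0), (fun=> 0).
by split=> [[]|] //; rewrite big_ord0.
Qed.

Lemma lower_central_sum n m (c : 'I_m -> k) (v : 'I_m -> L) :
  (forall i, lower_central L n (v i)) -> lower_central L n (\sum_i c i *: v i).
Proof.
move=> vn; apply: (big_ind (lower_central L n)); first exact: lower_central0.
  by move=> x y xn yn; rewrite -[x]scale1r; apply: lower_central_linear.
move=> i _; rewrite -[_ *: _]addr0; apply: lower_central_linear => //.
exact: lower_central0.
Qed.

Lemma lower_central_bracket1 n x y :
  lower_central L n y -> lower_central L n.+1 (bracket x y).
Proof.
move=> yn; exists 1%N, (fun=> 1), (fun=> x), (fun=> y); split=> //.
by rewrite big_ord1 scale1r.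
Qed.

Lemma lower_central_bracket m n x y : lower_central L m x ->
  lower_central L n y -> lower_central L (m + n).+1 (bracket x y).
Proof.
elim: m n x y => [|m IHm] n x y.
  by move=> _; apply: lower_central_bracket1.
move=> [p [c [u [v [vm ->]]]]] yn.
rewrite bracketC linear_sum -sumrN.
rewrite (eq_bigr (fun i => c i *: (bracket (u i) (bracket (v i) y)
    - bracket (v i) (bracket (u i) y)))); last first.
  move=> i _; rewrite linearZ -bracket_jacobi.
  by rewrite (bracketC (bracket _ _)) scalerN.
apply: lower_central_sum => i; rewrite -[_ - _]addrC -scaleN1r.
apply: lower_central_linear.
  rewrite addSnnS; apply: IHm (vm i) _; exact: lower_central_bracket1.
by rewrite addSn; apply: lower_central_bracket1; apply: IHm (vm i) yn.
Qed.

Lemma lower_central_decr n x : lower_central L n.+1 x -> lower_central L n x.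
Proof.
elim: n x => [//|n IHn] x [p [c [u [v [vm ->]]]]].
apply: lower_central_sum => i.
by apply: lower_central_bracket1; apply: IHn (vm i).
Qed.

Lemma lower_central_eq0 n m x : (forall y, lower_central L n y -> y = 0) ->
  (n <= m)%N -> lower_central L m x -> x = 0.
Proof.
move=> n0 /subnK <-; elim: (m - n)%N => [|d IHd]; first exact: n0.
by rewrite addSn => /lower_central_decr.
Qed.

End LieAlgebra.

(** A subspace contained in P of largest dimension is all of P: otherwise one
    more line could be added. *)
Lemma linear_closed_vspace (k : fieldType) (V : vectType k) (P : set V) :
  P 0 -> (forall a x y, P x -> P y -> P (a *: x + y)) ->
  exists W : {vspace V}, forall x, P x <-> x \in W.
Proof.
move=> P0 Plin.
pose D n :=
  `[< exists2 W : {vspace V}, \dim W = n & forall x, x \in W -> P x >].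
have exD : exists n, D n.
  exists 0%N; apply/asboolP; exists 0%VS; first by rewrite dimv0.
  by move=> x; rewrite memv0 => /eqP->.
have leD n : D n -> (n <= \dim {:V})%N.
  by move=> /asboolP[W <- _]; apply/dimvS/subvf.
case: (ex_maxnP exD leD) => n /asboolP[W dimW WP] max_n.
exists W => x; split=> [Px|]; last exact: WP.
have WxP y : y \in (<[x]> + W)%VS -> P y.
  case/memv_addP => _ /vlineP[a ->] [w Ww ->].
  by apply: Plin => //; apply: WP.
have /dimv_leqif_eq/geq_leqif := addvSr <[x]> W.
rewrite dimW max_n; last by apply/asboolP; exists (<[x]> + W)%VS.
by move=> /esym/eqP ->; rewrite memvE addvSl.
Qed.

Lemma lower_central_vspaces (k : fieldType) (L : finLieAlgType k) :
  exists V : nat -> {vspace L},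
    forall n x, lower_central L n x <-> x \in V n.
Proof.
suff /choice[V VP] : forall n, exists W : {vspace L},
    forall x, lower_central L n x <-> x \in W by exists V.
move=> n; apply: linear_closed_vspace; first exact: lower_central0.
by move=> a x y; apply: lower_central_linear.
Qed.

(** * The enveloping algebra and its augmentation ideal *)

Section Envelope.

Context (k : fieldType) (L : lieAlgType k).
Local Notation U := (envelope L).
Local Notation I := (augmentation_ideal L).

HB.instance Definition _ := GRing.isLinear.Build k L U _ (@envelope_gen k L)
  (proj1 (envelope_gen_is_lie_hom L)).

Lemma envelope_gen_bracket (x y : L) : envelope_gen (bracket x y) =
  envelope_gen x * envelope_gen y - envelope_gen y * envelope_gen x.
Proof. exact: (proj2 (envelope_gen_is_lie_hom L)). Qed.

Lemma envelope_alg_ind (P : U -> Prop) :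
  (forall x, P (envelope_gen x)) -> (forall a : k, P a%:A) ->
  (forall u v, P u -> P v -> P (u + v)) ->
  (forall u v, P u -> P v -> P (u * v)) -> forall u, P u.
Proof.
move=> Pgen Pscal Padd Pmul; elim/envelope_ind; elim.
- exact: Pgen.
- move=> a; have := Pscal a.
  by have -> : a%:A = envelope_scal L a by exact: (mulr1 (envelope_scal L a)).
- by move=> s Ps t Pt; rewrite -envelope_pi_add; apply: Padd.
- by move=> s Ps t Pt; rewrite -envelope_pi_mul; apply: Pmul.
Qed.

Lemma augmentation_gen (x : L) : augmentation (envelope_gen x) = 0.
Proof. exact: envelope_lift_gen (zero_is_lie_hom L k^o) x. Qed.

Lemma augmentation_ideal_gen (x : L) : ideal_set I (envelope_gen x).
Proof. exact: augmentation_gen. Qed.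

Lemma augmentation_scal (a : k) : augmentation (a%:A : U) = a.
Proof. by rewrite linearZ rmorph1; apply: mulr1. Qed.

(** The left ideal generated by L contains u minus its augmentation for every u,
    by induction on u: for a product, u v - e(u) e(v) is
    u (v - e(v)) + e(v) (u - e(u)). *)
Lemma augmentation_ideal_min (P : set U) : left_ideal P ->
  (forall x, P (envelope_gen x)) -> forall u, ideal_set I u -> P u.
Proof.
move=> [P0 PD PM] Pgen.
pose eps (u : U) : k := augmentation u.
suff Paug (u : U) : P (u - (eps u)%:A).
  by move=> u u0; have := Paug u; rewrite (u0 : eps u = 0) scale0r subr0.
elim/envelope_alg_ind: u.
- by move=> x; rewrite /eps augmentation_gen scale0r subr0.
- by move=> a; rewrite /eps augmentation_scal subrr.
- by move=> u v Pu Pv; rewrite /eps raddfD scalerDl opprD addrACA; apply: PD.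
- move=> u v Pu Pv; have -> : u * v - (eps (u * v))%:A =
      u * (v - (eps v)%:A) + (eps v)%:A * (u - (eps u)%:A).
    rewrite /eps rmorphM -/(eps u) -/(eps v).
    rewrite !mulrBr -!scalerAr -!scalerAl !mulr1 mul1r scalerA addrA subrK.
    by rewrite mulrC.
  by apply: PD; apply: PM.
Qed.

Lemma ideal_pow1 (R : nzRingType) (J : set R) x : J x -> ideal_pow J 1 x.
Proof.
by exists 1%N, (fun=> x), (fun=> 1); rewrite big_ord1 mulr1; split.
Qed.

Lemma ideal_pow_mono (R : nzRingType) (J : two_sided_ideal R) m n x :
  (m <= n)%N -> ideal_pow J n x -> ideal_pow J m x.
Proof.
move=> /subnK <-; rewrite addnC; elim: (n - m)%N x => [|d IHd] x.
  by rewrite addn0.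
rewrite addnS => -[p [a [b [abJ ->]]]]; apply: ideal_pow_sum => i.
by have [_ _ JM] := ideal_pow_left J m; apply: JM; apply: IHd; case: (abJ i).
Qed.

Lemma ideal_powZ n (a : k) u : ideal_pow I n u -> ideal_pow I n (a *: u).
Proof.
rewrite -[u in a *: u]mul1r scalerAl.
by have [_ _] := ideal_pow_left I n; apply.
Qed.

(** A bracket [x, y] with y in I^(n+1) is x y - y x, and both products lie in
    I^(n+2) as x lies in I. *)
Lemma lower_central_ideal_pow n (x : L) :
  lower_central L n x -> ideal_pow I n.+1 (envelope_gen x).
Proof.
elim: n x => [|n IHn] x.
  by move=> _; exact/ideal_pow1/augmentation_ideal_gen.
move=> [p [c [u [v [vn ->]]]]]; rewrite linear_sum; apply: ideal_pow_sum => i.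
rewrite linearZ; apply: ideal_powZ; rewrite /= envelope_gen_bracket.
have [_ ID IM] := ideal_pow_left I n.+2.
apply: ID; first by rewrite -[n.+2]add1n; apply: ideal_pow_mul (IHn _ (vn i));
  apply/ideal_pow1/augmentation_ideal_gen.
rewrite -mulN1r; apply: IM; rewrite -[n.+2]addn1.
apply: ideal_pow_mul (IHn _ (vn i)) _.
exact/ideal_pow1/augmentation_ideal_gen.
Qed.

End Envelope.

Section EnvelopeLift.

Context (k : fieldType) (L : lieAlgType k) (A : algType k) (f : L -> A).
Hypothesis f_lie : is_lie_hom f.

Lemma envelope_liftD u v :
  envelope_lift f (u + v) = envelope_lift f u + envelope_lift f v.
Proof. by have := envelope_lift_linear f_lie 1 u v; rewrite !scale1r. Qed.

Lemma envelope_liftM u v :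
  envelope_lift f (u * v) = envelope_lift f u * envelope_lift f v.
Proof. by have [_] := envelope_lift_monoid_morphism f_lie; apply. Qed.

Lemma envelope_lift_scal (a : k) : envelope_lift f a%:A = a%:A.
Proof.
have /(_ 0 0) := envelope_liftD.
rewrite addr0 -[LHS]addr0 => /addrI/esym f0.
have [f1 _] := envelope_lift_monoid_morphism f_lie.
by have := envelope_lift_linear f_lie a 1 0; rewrite f0 f1 !addr0.
Qed.

End EnvelopeLift.

(** * Nilpotent Lie algebras: the Rees algebra is left Noetherian *)

Section NilpotentImpliesNoetherian.

Context (k : fieldType) (L : finLieAlgType k).
Local Notation U := (envelope L).
Local Notation I := (augmentation_ideal L).

Definition scalar_polys : set {poly U} :=
  [set p | exists a : k, p = (a%:A)%:P]%classic.

Lemma scalar_polys_subring : subring_set scalar_polys.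
Proof.
split; first by exists 1; rewrite scale1r.
- by move=> _ _ [a ->] [b ->]; exists (a - b); rewrite scalerBl polyCB.
- by move=> _ _ [a ->] [b ->]; exists (a * b);
    rewrite -polyCM -scalerAl mul1r scalerA.
Qed.

Lemma scalar_polys_central a p : scalar_polys a -> p * a = a * p.
Proof.
move=> [c ->]; apply/polyP => i; rewrite coefMC coefCM.
by rewrite -scalerAl -scalerAr mul1r mulr1.
Qed.

Lemma scalar_polys_noetherian : left_noetherian_in scalar_polys.
Proof.
move=> J Jid.
(* The scalars form a field, so a nonzero ideal contains 1. *)
have [[a [a0 Ja]]|noJ] := pselect (exists a : k, a != 0 /\ J (a%:A)%:P).
  exists [:: 1] => [g|p /(left_ideal_in_sub Jid) pK].
    rewrite inE => /eqP->.
    have -> : 1 = (a^-1%:A)%:P * (a%:A)%:P :> {poly U}.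
      by rewrite -polyCM -scalerAl mul1r scalerA mulVf // scale1r.
    by apply: (left_ideal_inM Jid) => //; exists a^-1.
  rewrite -[p]mulr1; apply: left_spanM => //.
  by apply: left_span_gen; apply: mem_head.
exists [::] => // p Jp; have [a pE] := left_ideal_in_sub Jid Jp.
have [a0|a0] := eqVneq a 0; last by case: noJ; exists a; rewrite -pE.
by rewrite pE a0 scale0r polyC0; apply: left_span0.
Qed.

Section Levels.

Context (V : nat -> {vspace L}).
Hypothesis VP : forall n x, lower_central L n x <-> x \in V n.

(** The generators of level n; the exponents j <= n + 1 are those for which
    e X^j lies in the Rees algebra, e being in I^(n+1). *)
Definition rees_level (n : nat) : seq {poly U} :=
  [seq (envelope_gen e)%:P * 'X^j | e : L <- vbasis (V n), j <- iota 0 n.+2].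

Fixpoint rees_levels (n d : nat) : seq {poly U} :=
  rees_level n ++ (if d is d'.+1 then rees_levels n.+1 d' else [::]).

Local Notation gen := (subring_gen scalar_polys).

Lemma rees_levelP n p : p \in rees_level n ->
  exists x j, [/\ lower_central L n x, (j <= n.+1)%N &
    p = (envelope_gen x)%:P * 'X^j].
Proof.
case/allpairsP=> -[x j] []; rewrite mem_iota => xV jn ->; exists x, j.
by split=> //; apply/VP/vbasis_mem.
Qed.

Lemma rees_levelsP n d p : p \in rees_levels n d ->
  exists m, (n <= m <= n + d)%N /\ p \in rees_level m.
Proof.
elim: d n => [|d IHd] n /=; rewrite mem_cat => /orP[pn|].
- by exists n; rewrite addn0 leqnn.
- by [].
- by exists n; rewrite leqnn leq_addr.
- by move=> /IHd[m [/andP[nm md] pm]]; exists m; rewrite -addSnnS md ltnW.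
Qed.

Lemma rees_levels_mem n d m p : (n <= m <= n + d)%N ->
  p \in rees_level m -> p \in rees_levels n d.
Proof.
elim: d n => [|d IHd] n /andP[nm md] pm /=; rewrite mem_cat.
  by rewrite addn0 in md; rewrite (@anti_leq n m) ?pm // nm.
move: nm; rewrite leq_eqVlt => /predU1P[->|nm]; first by rewrite pm.
by rewrite (IHd n.+1) ?orbT // nm addSnnS.
Qed.

Lemma rees_levels_gen n d m x j : (n <= m <= n + d)%N -> lower_central L m x ->
  (j <= m.+1)%N -> gen (rees_levels n d) ((envelope_gen x)%:P * 'X^j).
Proof.
move=> nmd /VP xV jm; have gring := subring_gen_subring scalar_polys_subring.
have scalE a (y : L) : (envelope_gen (a *: y))%:P =
    (a%:A)%:P * (envelope_gen y)%:P :> {poly U}.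
  by rewrite linearZ /= -polyCM -scalerAl mul1r.
rewrite (coord_vbasis xV) linear_sum raddf_sum mulr_suml.
apply: subring_set_sum => [|i _]; first exact: gring.
rewrite /= scalE.
rewrite -mulrA; apply: subring_genM.
  by apply: subring_gen_base; exists (coord (vbasis (V m)) i x).
apply: subring_gen_mem; apply: rees_levels_mem nmd _.
apply: allpairs_f; last by rewrite mem_iota.
by apply: mem_nth; rewrite size_tuple.
Qed.

(** Adding the levels from n + d down to n. The commutators of the elements of a
    level with those of this or higher levels lie in strictly higher levels,
    which are already there or, from level N on, vanish. *)
Lemma rees_levels_noetherian N n d : (forall x, lower_central L N x -> x = 0) ->
  (N <= (n + d).+1)%N -> left_noetherian_in (gen (rees_levels n d)).
Proof.
move=> N0.
have step n' ys : (forall m x j, (n' < m)%N -> lower_central L m x ->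
      (j <= m.+1)%N -> gen ys ((envelope_gen x)%:P * 'X^j)) ->
    (forall p, p \in ys -> exists m, (n' < m)%N /\ p \in rees_level m) ->
    left_noetherian_in (gen ys) ->
    left_noetherian_in (gen (rees_level n' ++ ys)).
  move=> ysgen ysP ysN; apply: subring_gen_cat_noetherian => //.
  - exact: scalar_polys_subring.
  - exact: scalar_polys_central.
  move=> p q /rees_levelP[x [i [xn in' ->]]] qP.
  have [m [nm /rees_levelP[y [j [ym jm ->]]]]] :
      exists m, (n' <= m)%N /\ q \in rees_level m.
    move: qP; rewrite mem_cat => /orP[qn|/ysP[m [/ltnW nm qm]]].
      by exists n'.
    by exists m.
  have -> : (envelope_gen x)%:P * 'X^i * ((envelope_gen y)%:P * 'X^j) -
     (envelope_gen y)%:P * 'X^j * ((envelope_gen x)%:P * 'X^i) =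
     (envelope_gen (bracket x y))%:P * 'X^(i + j) :> {poly U}.
    have comm (u v : U) a b :
        u%:P * 'X^a * (v%:P * 'X^b) = (u * v)%:P * 'X^(a + b).
      by rewrite -mulrA (mulrA 'X^a) -(commr_polyXn _ a) polyCM exprD !mulrA.
    by rewrite !comm (addnC j i) -mulrBl -polyCB -envelope_gen_bracket.
  apply: (ysgen (n' + m).+1); first by rewrite ltnS leq_addr.
    exact: lower_central_bracket.
  by rewrite -addSn -addnS leq_add.
elim: d n => [|d IHd] n Nn /=.
  apply: step => //; last first.
    apply: subring_gen_nil_noetherian; first exact: scalar_polys_subring.
    exact: scalar_polys_noetherian.
  move=> m x j nm xm _; rewrite (lower_central_eq0 N0 _ xm) ?linear0 ?mul0r.
    apply: subring_set0; apply: subring_gen_subring.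
    exact: scalar_polys_subring.
  by apply: leq_trans Nn _; rewrite addn0.
apply: step; last by apply: IHd; rewrite addSnnS.
  move=> m x j nm xm jm; have [md|md] := leqP m (n + d.+1).
    by apply: rees_levels_gen xm jm; rewrite nm addSnnS.
  rewrite (lower_central_eq0 N0 _ xm) ?linear0 ?mul0r.
    apply: subring_set0; apply: subring_gen_subring.
    exact: scalar_polys_subring.
  exact: leq_trans Nn md.
by move=> p /rees_levelsP[m [/andP[nm _] pm]]; exists m.
Qed.

(** Level 0 supplies x and x X for x in L, hence U, hence I X as I is the left
    ideal generated by L, and hence I^n X^n by taking products. *)
Lemma rees_levels_eq d p : gen (rees_levels 0 d) p <-> p \in rees_pred I.
Proof.
have gring := subring_gen_subring scalar_polys_subring (rees_levels 0 d).
split.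
  elim=> {p}.
  - move=> _ [a ->]; apply/rees_predP => -[//|n].
    by rewrite coefC; have [] := ideal_pow_left I n.+1.
  - move=> p /rees_levelsP[m [_ /rees_levelP[x [j [xm jm ->]]]]].
    apply/rees_predP => n; rewrite coefCM coefXn.
    have [->|_] := eqVneq n j.
      rewrite mulr1; apply: ideal_pow_mono jm _; exact: lower_central_ideal_pow.
    by rewrite mulr0; have [] := ideal_pow_left I n.
  - by move=> p q _ pI _ qI; apply: rpredB.
  - by move=> p q _ pI _ qI; apply: rpredM.
have genU (u : U) : gen (rees_levels 0 d) u%:P.
  elim/envelope_alg_ind: u.
  - move=> x; rewrite -[_%:P]mulr1 -(expr0 'X).
    exact: (@rees_levels_gen 0 d 0).
  - by move=> a; apply: subring_gen_base; exists a.
  - by move=> u v ug vg; rewrite polyCD; apply: subring_setD.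
  - by move=> u v ug vg; rewrite polyCM; apply: subring_setM.
have genI (u : U) : ideal_set I u -> gen (rees_levels 0 d) (u%:P * 'X).
  apply: (@augmentation_ideal_min _ _
    [set v | gen (rees_levels 0 d) (v%:P * 'X)]%classic); last first.
    by move=> x; rewrite -(expr1 'X); apply: (@rees_levels_gen 0 d 0).
  split.
  - by rewrite /= polyC0 mul0r; apply: subring_set0.
  - by move=> v w vg wg; rewrite /= polyCD mulrDl; apply: subring_setD.
  - by move=> v w wg; rewrite /= polyCM -mulrA; apply: subring_setM.
have genIn n u : ideal_pow I n u -> gen (rees_levels 0 d) (u%:P * 'X^n).
  elim: n u => [|n IHn] u; first by move=> _; rewrite mulr1.
  move=> [m [a [b [abI ->]]]]; rewrite rmorph_sum mulr_suml.
  apply: (subring_set_sum gring) => i _; have [aI bI] := abI i.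
  have -> : (a i * b i)%:P * 'X^(n.+1) =
      (a i)%:P * 'X * ((b i)%:P * 'X^n) :> {poly U}.
    rewrite polyCM exprS -!mulrA; congr (_ * _).
    by rewrite !mulrA commr_polyX.
  by apply: subring_setM => //; [apply: genI|apply: IHn].
move=> /rees_predP pI; rewrite -[p]coefK poly_def.
by apply: (subring_set_sum gring) => i _; rewrite -mul_polyC; apply: genIn.
Qed.

End Levels.

Lemma nilpotent_rees_noetherian : nilpotent_lie L ->
  graded_left_noetherian (rees_grading I).
Proof.
move=> [N N0] J [[J0 JD JM] _].
have [V VP] := lower_central_vspaces L.
have RN := rees_levels_noetherian VP (n := 0) (d := N) N0 (leqnSn N).
have Rid : left_ideal_in (subring_gen scalar_polys (rees_levels V 0 N))
    [set p | exists2 r : rees I, J r & rees_val r = p]%classic.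
  split.
  - by move=> _ [r _ <-]; apply/(rees_levels_eq VP); case: r.
  - by exists 0.
  - by move=> _ _ [r Jr <-] [s Js <-]; exists (r + s) => //; apply: JD.
  - move=> p _ /(rees_levels_eq VP) pI [r Jr <-]; exists (Rees pI * r) => //.
    exact: JM.
have [G GJ JG] := RN _ Rid.
have [g gP] : exists g : 'I_(size G) -> rees I,
    forall i, J (g i) /\ rees_val (g i) = G`_i.
  suff /choice[g gP] : forall i : 'I_(size G), exists r : rees I,
      J r /\ rees_val r = G`_i by exists g.
  by move=> i; have [r Jr rE] := GJ _ (mem_nth 0 (ltn_ord i)); exists r.
exists (size G), g => r; split=> [Jr|[c ->]]; last first.
  by apply: big_ind => // i _; apply: JM; case: (gP i).
have rspan := JG (rees_val r) (ex_intro2 _ _ r Jr erefl).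
have [c cP rE] :=
  left_spanE (subring_gen_subring scalar_polys_subring _) rspan.
have cI i : c i \in rees_pred I by apply/(rees_levels_eq VP N).
exists (fun i => Rees (cI i)); apply: (val_inj : injective (@rees_val _ I)).
rewrite rees_val_sum rE; apply: eq_bigr => i _.
by have [_ <-] := gP i.
Qed.

End NilpotentImpliesNoetherian.

(** * Differential operators on a commutative algebra *)

Section Endomorphisms.

Context (k : fieldType) (S : comAlgType k).

Record endo := Endo { endo_fun :> S -> S; endo_linear : linear endo_fun }.

HB.instance Definition _ := gen_eqMixin endo.
HB.instance Definition _ := gen_choiceMixin endo.
HB.instance Definition _ (D : endo) :=
  GRing.isLinear.Build k S S _ (endo_fun D) (endo_linear D).

Lemma endoP (D E : endo) : D =1 E -> D = E.
Proof.
case: D E => [D Dlin] [E Elin] /= /funext DE.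
by case: E / DE Elin => Elin; congr (@Endo _); apply: Prop_irrelevance.
Qed.

Program Definition endo_zero := @Endo (fun=> 0) _.
Next Obligation. by move=> a x y; rewrite scaler0 addr0. Qed.

Program Definition endo_one := @Endo (fun x => x) _.
Next Obligation. by []. Qed.

Program Definition endo_opp (D : endo) := @Endo (fun x => - D x) _.
Next Obligation. by move=> a x y; rewrite linearP opprD scalerN. Qed.

Program Definition endo_add (D E : endo) := @Endo (fun x => D x + E x) _.
Next Obligation.
by move=> a x y; rewrite !linearP scalerDr addrACA.
Qed.

Program Definition endo_comp (D E : endo) := @Endo (fun x => D (E x)) _.
Next Obligation. by move=> a x y; rewrite !linearP. Qed.

Program Definition endo_scale (a : k) (D : endo) := @Endo (fun x => a *: D x) _.
Next Obligation.
by move=> b x y; rewrite linearP scalerDr !scalerA mulrC.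
Qed.

Let addA : associative endo_add.
Proof. by move=> D E F; apply: endoP => x; apply: addrA. Qed.

Let addC : commutative endo_add.
Proof. by move=> D E; apply: endoP => x; apply: addrC. Qed.

Let add0 : left_id endo_zero endo_add.
Proof. by move=> D; apply: endoP => x; apply: add0r. Qed.

Let addN : left_inverse endo_zero endo_opp endo_add.
Proof. by move=> D; apply: endoP => x; apply: addNr. Qed.

HB.instance Definition _ := GRing.isZmodule.Build endo addA addC add0 addN.

Let mulA : associative endo_comp.
Proof. by move=> D E F; apply: endoP. Qed.

Let mul1 : left_id endo_one endo_comp.
Proof. by move=> D; apply: endoP. Qed.

Let mulr1 : right_id endo_one endo_comp.
Proof. by move=> D; apply: endoP. Qed.

Let mulDl : left_distributive endo_comp endo_add.
Proof. by move=> D E F; apply: endoP. Qed.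

Let mulDr : right_distributive endo_comp endo_add.
Proof. by move=> D E F; apply: endoP => x; apply: linearD. Qed.

Let one_neq0 : endo_one != 0 :> endo.
Proof.
apply/eqP => /(congr1 (fun D : endo => D 1)) /= /eqP.
by rewrite oner_eq0.
Qed.

HB.instance Definition _ := GRing.Zmodule_isNzRing.Build endo
  mulA mul1 mulr1 mulDl mulDr one_neq0.

Let scaleA (a b : k) (D : endo) :
  endo_scale a (endo_scale b D) = endo_scale (a * b) D.
Proof. by apply: endoP => x; apply: scalerA. Qed.

Let scale1 : left_id 1 endo_scale.
Proof. by move=> D; apply: endoP => x; apply: scale1r. Qed.

Let scaleDr : right_distributive endo_scale +%R.
Proof. by move=> a D E; apply: endoP => x; apply: scalerDr. Qed.

Let scaleDl (D : endo) : {morph endo_scale^~ D : a b / a + b}.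
Proof. by move=> a b; apply: endoP => x; apply: scalerDl. Qed.

HB.instance Definition _ := GRing.Zmodule_isLmodule.Build k endo
  scaleA scale1 scaleDr scaleDl.

Let scaleAl (a : k) (D E : endo) : a *: (D * E) = a *: D * E.
Proof. exact: endoP. Qed.

HB.instance Definition _ := GRing.Lmodule_isLalgebra.Build k endo scaleAl.

Let scaleAr (a : k) (D E : endo) : a *: (D * E) = D * (a *: E).
Proof. by apply: endoP => x; apply/esym/linearZ. Qed.

HB.instance Definition _ := GRing.Lalgebra_isAlgebra.Build k endo scaleAr.

Lemma endoD (D E : endo) x : (D + E) x = D x + E x. Proof. by []. Qed.
Lemma endoB (D E : endo) x : (D - E) x = D x - E x. Proof. by []. Qed.
Lemma endoM (D E : endo) x : (D * E) x = D (E x). Proof. by []. Qed.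
Lemma endoZ a (D : endo) x : (a *: D) x = a *: D x. Proof. by []. Qed.
Lemma endo1 x : (1 : endo) x = x. Proof. by []. Qed.

Program Definition mulop (h : S) := @Endo (fun x => h * x) _.
Next Obligation. by move=> a x y; rewrite mulrDr scalerAr. Qed.

(** Grothendieck's differential operators, of order < n: the commutators with
    multiplications are of order < n - 1, and only 0 has order < 0. This
    definition behaves well in every characteristic. *)
Fixpoint diffop (n : nat) (D : endo) : Prop :=
  if n is n'.+1 then forall h, diffop n' (D * mulop h - mulop h * D)
  else D = 0.

Lemma diffop0 n : diffop n 0.
Proof. by elim: n => [//|n IHn] h /=; rewrite mul0r mulr0 subrr. Qed.

Lemma diffopS n D : diffop n D -> diffop n.+1 D.
Proof.
elim: n D => [|n IHn] D; first by move=> -> h; rewrite mul0r mulr0 subrr.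
by move=> Dn h; apply: IHn; apply: Dn.
Qed.

Lemma diffop_mono m n D : (m <= n)%N -> diffop m D -> diffop n D.
Proof.
move=> /subnK <- Dm; elim: (n - m)%N => [//|d IHd].
by rewrite addSn; apply: diffopS.
Qed.

Lemma diffopD n D E : diffop n D -> diffop n E -> diffop n (D + E).
Proof.
elim: n D E => [|n IHn] D E /=; first by move=> -> ->; rewrite addr0.
move=> Dn En h; rewrite mulrDl mulrDr opprD addrACA.
exact: IHn.
Qed.

(** The commutator with a multiplication satisfies Leibniz' rule, which splits
    the product into two products of smaller total order. *)
Lemma diffopM m n D E : diffop m D -> diffop n E -> diffop (m + n) (D * E).
Proof.
elim: m n D E => [|m IHm] n D E.
  by move=> -> _; rewrite mul0r; apply: diffop0.
elim: n D E => [|n IHn] D E.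
  by move=> _ ->; rewrite mulr0; apply: diffop0.
move=> Dm En h.
have -> : D * E * mulop h - mulop h * (D * E) =
    D * (E * mulop h - mulop h * E) + (D * mulop h - mulop h * D) * E.
  by rewrite mulrBr mulrBl !mulrA addrA subrK.
apply: diffopD; first by have := IHn _ _ Dm (En h); rewrite addSnnS.
exact: IHm (Dm h) En.
Qed.

Lemma mulopC g h : mulop g * mulop h = mulop h * mulop g.
Proof. by apply: endoP => x; rewrite /= mulrCA. Qed.

Lemma diffop_mulop h : diffop 1 (mulop h).
Proof. by move=> g /=; rewrite mulopC subrr. Qed.

Lemma diffop_scalar a : diffop 1 a%:A.
Proof.
by move=> h; rewrite /= -scalerAl -scalerAr mul1r Monoid.mulm1 subrr.
Qed.

Lemma diffop_derivation (D : endo) :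
  (forall f g, D (f * g) = D f * g + f * D g) -> diffop 2 D.
Proof.
move=> Dder h; have -> : D * mulop h - mulop h * D = mulop (D h).
  by apply: endoP => x; rewrite endoB !endoM /= Dder addrK.
exact: diffop_mulop.
Qed.

Definition is_diffop (D : endo) := exists n, diffop n D.

Lemma is_diffopD D E : is_diffop D -> is_diffop E -> is_diffop (D + E).
Proof.
move=> [m Dm] [n En]; exists (maxn m n); apply: diffopD.
  by apply: diffop_mono Dm; apply: leq_maxl.
by apply: diffop_mono En; apply: leq_maxr.
Qed.

Lemma is_diffopM D E : is_diffop D -> is_diffop E -> is_diffop (D * E).
Proof. by move=> [m Dm] [n En]; exists (m + n)%N; apply: diffopM. Qed.

(** The commutators of D with multiplications also kill the ideal generated by
    l, so they vanish by induction on the order. Then D is multiplication by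
    D 1, and l D 1 = D l = 0. *)
Lemma diffop_mulop_eq0 D l : GRing.lreg l -> is_diffop D -> D * mulop l = 0 ->
  D = 0.
Proof.
move=> lreg [n]; elim: n D => [//|n IHn] D Dn Dl0.
have Dcomm h : D * mulop h = mulop h * D.
  apply/eqP; rewrite -subr_eq0; apply/eqP; apply: IHn; first exact: Dn.
  by rewrite mulrBl -mulrA -mulopC mulrA Dl0 -mulrA Dl0 mul0r mulr0 subrr.
have DE f : D f = f * D 1.
  have /(congr1 (fun E : endo => E 1)) := Dcomm f.
  by rewrite !endoM /= Monoid.mulm1.
have D1 : D 1 = 0.
  apply: lreg; rewrite mulr0 -DE.
  have /(congr1 (fun E : endo => E 1)) := Dl0.
  by rewrite endoM /= Monoid.mulm1.
by apply: endoP => f; rewrite DE D1 mulr0.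
Qed.

End Endomorphisms.

(** A copy of {poly A} that carries the k-algebra structure inherited from A, as
    {poly A} itself is a module over A. *)
Definition poly_over (k : fieldType) (A : algType k) : Type := {poly A}.

Section PolyOver.

Context (k : fieldType) (A : algType k).
Local Notation P := (poly_over A).

HB.instance Definition _ := GRing.NzRing.on P.

Definition poly_over_scale (a : k) (p : P) : P := (a%:A)%:P * p.

Lemma coef_poly_over_scale a (p : P) i :
  (poly_over_scale a p : {poly A})`_i = a *: (p : {poly A})`_i.
Proof. by rewrite coefCM -scalerAl mul1r. Qed.

Let scaleA (a b : k) (p : P) :
  poly_over_scale a (poly_over_scale b p) = poly_over_scale (a * b) p.
Proof. by apply/polyP => i; rewrite !coef_poly_over_scale scalerA. Qed.

Let scale1 : left_id 1 poly_over_scale.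
Proof. by move=> p; apply/polyP => i; rewrite coef_poly_over_scale scale1r. Qed.

Let scaleDr : right_distributive poly_over_scale +%R.
Proof. by move=> a p q; apply: mulrDr. Qed.

Let scaleDl (p : P) : {morph poly_over_scale^~ p : a b / a + b}.
Proof.
by move=> a b; apply/polyP => i; rewrite coefD !coef_poly_over_scale scalerDl.
Qed.

HB.instance Definition _ := GRing.Zmodule_isLmodule.Build k P
  scaleA scale1 scaleDr scaleDl.

Let scaleAl (a : k) (p q : P) : a *: (p * q) = a *: p * q.
Proof. exact: mulrA. Qed.

HB.instance Definition _ := GRing.Lmodule_isLalgebra.Build k P scaleAl.

Let scaleAr (a : k) (p q : P) : a *: (p * q) = p * (a *: q).
Proof.
apply/polyP => i; rewrite coef_poly_over_scale !coefM scaler_sumr.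
by apply: eq_bigr => j _; rewrite coef_poly_over_scale scalerAr.
Qed.

HB.instance Definition _ := GRing.Lalgebra_isAlgebra.Build k P scaleAr.

Lemma coef_poly_overZ a (p : P) i :
  (a *: p : {poly A})`_i = a *: (p : {poly A})`_i.
Proof. exact: coef_poly_over_scale. Qed.

End PolyOver.

Lemma linear_polyM (R : nzRingType) (a b c d : R) :
  (a%:P + b%:P * 'X) * (c%:P + d%:P * 'X) =
  (a * c)%:P + (a * d + b * c)%:P * 'X + (b * d)%:P * 'X^2.
Proof.
rewrite mulrDl !mulrDr polyCD !polyCM expr2 mulrDl !mulrA.
rewrite -(mulrA _ 'X c%:P) -commr_polyX -(mulrA _ 'X d%:P) -commr_polyX.
by rewrite !mulrA !addrA.
Qed.

(** * The action of a Lie algebra on its symmetric algebra *)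

Section SymmetricAlgebraAction.

Context (k : fieldType) (L : finLieAlgType k).
Local Notation n := (\dim {:L}).
Local Notation e i := (vbasis {:L})`_i.
Local Notation S := {mpoly k[n]}.
Implicit Types (x y v : L) (p q : S).

(** The embedding of L in its symmetric algebra, the polynomial ring on a basis
    of L. *)
Definition sym_gen v : S := \sum_i coord (vbasis {:L}) i v *: 'X_i.

Lemma sym_gen_linear : linear sym_gen.
Proof.
move=> a x y; rewrite /sym_gen scaler_sumr -big_split; apply: eq_bigr => i _.
by rewrite linearP scalerDl scalerA.
Qed.

HB.instance Definition _ := GRing.isLinear.Build k L S _ sym_gen sym_gen_linear.

Lemma sym_gen_inj v : sym_gen v = 0 -> v = 0.
Proof.
move=> v0; rewrite (coord_vbasis (memvf v)) big1 // => i _.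
have /(congr1 (fun p => p@_U_(i))) := v0.
rewrite /sym_gen raddf_sum mcoeff0 (bigD1 i) //= big1 => [|j ji].
  by rewrite addr0 mcoeffZ mcoeffX eqxx mulr1 => ->; rewrite scale0r.
by rewrite mcoeffZ mcoeffX eq_mnm1 (negPf ji) mulr0.
Qed.

Lemma mderiv_sym_gen v i : (sym_gen v)^`M(i) = (coord (vbasis {:L}) i v)%:MP.
Proof.
rewrite /sym_gen linear_sum (bigD1 i) //= big1 => [|j ji].
  rewrite linearZ /=.
  have -> : 'X_i^`M(i) = 1 :> S.
    rewrite mderivX mnm1E eqxx scale1r -mpolyX0; congr mpolyX.
    by apply/mnmP => j; rewrite mnmBE mnm0E subnn.
  by rewrite addr0 -mul_mpolyC mulr1.
by rewrite linearZ /= mderivX mnm1E (negPf ji) scale0r scaler0.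
Qed.

Definition sym_der_fun x p : S :=
  \sum_(i < n) sym_gen (bracket x (e i)) * p^`M(i).

Lemma sym_der_linear x : linear (sym_der_fun x).
Proof.
move=> a p q; rewrite /sym_der_fun scaler_sumr -big_split.
by apply: eq_bigr => i _; rewrite linearP mulrDr scalerAr.
Qed.

Definition sym_der x : endo S := Endo (sym_der_linear x).

Lemma sym_derM x p q : sym_der x (p * q) = sym_der x p * q + p * sym_der x q.
Proof.
rewrite /= /sym_der_fun mulr_suml mulr_sumr -big_split; apply: eq_bigr => i _.
by rewrite mderivM mulrDr [p * (_ * _)]mulrCA !mulrA.
Qed.

Lemma sym_der_gen x v : sym_der x (sym_gen v) = sym_gen (bracket x v).
Proof.
have -> : bracket x v = \sum_i coord (vbasis {:L}) i v *: bracket x (e i).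
  rewrite {1}(coord_vbasis (memvf v)) linear_sum.
  by apply: eq_bigr => i _; rewrite linearZ.
rewrite [RHS]linear_sum /= /sym_der_fun.
apply: eq_bigr => i _.
by rewrite mderiv_sym_gen mulrC mul_mpolyC linearZ.
Qed.

(** A commutator of derivations is determined by its values on generators, where
    the claim is the Jacobi identity; in coordinates, the second order terms of
    the two products agree by symmetry of the second derivatives. *)
Lemma sym_der_bracket x y p :
  sym_der (bracket x y) p = sym_der x (sym_der y p) - sym_der y (sym_der x p).
Proof.
have twice (a b : L) : sym_der a (sym_der b p) =
    \sum_(i < n) sym_gen (bracket a (bracket b (e i))) * p^`M(i) +
    \sum_(i < n) \sum_(j < n)
      sym_gen (bracket b (e i)) * sym_gen (bracket a (e j)) * p^`M(i)^`M(j).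
  rewrite [sym_der b p]/= {1}/sym_der_fun linear_sum -big_split.
  apply: eq_bigr => i _; rewrite [LHS]sym_derM sym_der_gen; congr (_ + _).
  by rewrite mulr_sumr; apply: eq_bigr => j _; rewrite mulrA.
rewrite !twice [X in _ = _ + X - _]exchange_big /=.
set P := \sum_(i < n) \sum_(j < n) _.
set Q := \sum_(i < n) \sum_(j < n) _.
have -> : P = Q.
  apply: eq_bigr => i _; apply: eq_bigr => j _.
  by rewrite mderiv_comm (mulrC (sym_gen _)).
rewrite opprD addrACA subrr addr0 -sumrB; apply: eq_bigr => i _.
by rewrite -mulrBl -linearB bracket_jacobi.
Qed.

(** The derivations replace linear forms by linear forms, so the origin is a
    fixed point of the action. *)
Lemma sym_der_augmented x p : (sym_der x p).@[fun=> 0] = 0.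
Proof.
rewrite /= /sym_der_fun raddf_sum big1 //= => i _.
rewrite mevalM /sym_gen raddf_sum big1 ?mul0r // => j _.
by rewrite /= mevalZ mevalXU mulr0.
Qed.

End SymmetricAlgebraAction.

(** * Twisting a representation by a cocycle *)

(** For a representation D and a linear map c with values in E, the map
    x |-> D x + t c x is a representation in E[t] as soon as the c x commute and
    c is a 1-cocycle. The variable t keeps track of how often c was used, which
    is what gives a leading coefficient to work with. *)
Section Twist.

Context (k : fieldType) (L : lieAlgType k) (E : algType k) (D c : L -> E).
Local Notation U := (envelope L).
Local Notation P := (poly_over E).

Hypothesis D_lie : is_lie_hom D.
Hypothesis c_linear : linear c.
Hypothesis c_comm : forall x y, c x * c y = c y * c x.
Hypothesis c_cocycle : forall x y,
  (D x * c y - c y * D x) - (D y * c x - c x * D y) = c (bracket x y).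

Definition twist (x : L) : P := (D x)%:P + (c x)%:P * 'X.

Lemma coef_twist (x : L) i : (twist x : {poly E})`_i =
  if i is i'.+1 then (if i' is 0 then c x else 0) else D x.
Proof.
rewrite coefD coefC coefMX coefC.
by case: i => [|[|i]] /=; rewrite ?addr0 ?add0r.
Qed.

Lemma twist_is_lie_hom : is_lie_hom twist.
Proof.
split=> [a x y|x y].
  apply/polyP => i.
  rewrite [RHS]coefD [X in _ = X + _]coef_poly_overZ !coef_twist.
  case: i => [|[|i]]; last by rewrite scaler0 addr0.
    exact: (proj1 D_lie).
  exact: c_linear.
rewrite /twist !linear_polyM c_comm opprD addrACA subrr addr0.
rewrite opprD addrACA -polyCB -mulrBl -polyCB (proj2 D_lie).
congr (_ + _%:P * _); rewrite -c_cocycle opprB [LHS]addrACA opprD.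
by congr (_ + _); apply: addrC.
Qed.

Local Notation phi := (envelope_lift twist).

Lemma coef0_twist_lift (u : U) :
  (phi u : {poly E})`_0 = envelope_lift D u.
Proof.
have tw := twist_is_lie_hom.
elim/envelope_alg_ind: u.
- by move=> x; rewrite !envelope_lift_gen // coef_twist.
- by move=> a; rewrite !envelope_lift_scal // coef_poly_overZ coef1.
- by move=> u v IHu IHv; rewrite !envelope_liftD // coefD IHu IHv.
- by move=> u v IHu IHv; rewrite !envelope_liftM // coef0M IHu IHv.
Qed.

Section Invariant.

Context (Q : E -> Prop).
Hypothesis Q_scal : forall a : k, Q a%:A.
Hypothesis QD : forall y z, Q y -> Q z -> Q (y + z).
Hypothesis QM : forall y z, Q y -> Q z -> Q (y * z).
Hypothesis Q_D : forall x, Q (D x).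
Hypothesis Q_c : forall x, Q (c x).

Lemma twist_lift_coef_ind (u : U) i : Q (phi u : {poly E})`_i.
Proof.
have Q0 : Q 0 by rewrite -(scale0r 1).
have tw := twist_is_lie_hom.
elim/envelope_alg_ind: u i.
- by move=> x i; rewrite envelope_lift_gen // coef_twist; case: i => [|[|i]].
- move=> a i; rewrite envelope_lift_scal // coef_poly_overZ coef1.
  by case: (i == 0%N); rewrite ?scaler0.
- by move=> u v IHu IHv i; rewrite envelope_liftD // coefD; apply: QD.
- move=> u v IHu IHv i; rewrite envelope_liftM // coefM.
  by apply: (big_ind Q) => // j _; apply: QM.
Qed.

(** The operator of u is nonzero, already at t = 0, and its product with
    D x + t c x vanishes; the top coefficient in t of that product is the
    leading coefficient of the operator of u times c x. *)
Lemma twist_annihilator (u : U) (x : L) :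
  envelope_lift D u != 0 -> u * envelope_gen x = 0 ->
  exists T : E, [/\ T != 0, Q T & T * c x = 0].
Proof.
move=> Du ux.
pose T : {poly E} := phi u.
have T0 : T != 0.
  by apply: contra Du => /eqP T0; rewrite -coef0_twist_lift -/T T0 coef0.
exists (lead_coef T); split; first by rewrite lead_coef_eq0.
  exact: twist_lift_coef_ind.
have Tx : T * twist x = 0.
  rewrite -[twist x](envelope_lift_gen twist_is_lie_hom).
  rewrite -[LHS](envelope_liftM twist_is_lie_hom) ux.
  rewrite -(scale0r 1) envelope_lift_scal ?scale0r //.
  exact: twist_is_lie_hom.
have := congr1 (fun p : {poly E} => p`_(size T)) Tx.
rewrite coef0 mulrDr coefD coefMC nth_default // mul0r add0r mulrA coefMX.
by rewrite size_poly_eq0 (negPf T0) coefMC.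
Qed.

End Invariant.

End Twist.

(** * No generator is fixed by an augmentation ideal element *)

Section NoLeftFixedPoint.

Context (k : fieldType) (L : finLieAlgType k).
Local Notation n := (\dim {:L}).
Local Notation S := {mpoly k[n]}.
Local Notation U := (envelope L).

Lemma sym_der_is_lie_hom : is_lie_hom (@sym_der k L).
Proof.
split=> [a x y|x y]; apply: endoP => p; last exact: sym_der_bracket.
rewrite endoD endoZ /= /sym_der_fun scaler_sumr -big_split.
apply: eq_bigr => i _.
by rewrite linear_bracketl linearP mulrDl scalerAl.
Qed.

(** The action of U on S, followed by evaluation at the origin, factors through
    the augmentation since L acts by 0 there. *)
Lemma sym_lift_augmented (u : U) (p : S) :
  (envelope_lift (@sym_der k L) u p).@[fun=> 0] =
    (augmentation u : k) * p.@[fun=> 0].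
Proof.
have sl := sym_der_is_lie_hom.
elim/envelope_alg_ind: u p.
- move=> x p; rewrite envelope_lift_gen //.
  by rewrite sym_der_augmented augmentation_gen mul0r.
- move=> a p; rewrite augmentation_scal envelope_lift_scal //.
  by rewrite endoZ endo1 mevalZ.
- move=> u v IHu IHv p; rewrite [augmentation _]raddfD mulrDl -IHu -IHv -mevalD.
  by rewrite envelope_liftD.
- move=> u v IHu IHv p; rewrite [augmentation _]rmorphM envelope_liftM // endoM.
  by rewrite IHu IHv; apply: mulrA.
Qed.

(** Twisting by the coboundary x |-> [x, g] makes x act with the nonzero
    coefficient [x, g] in t, which only the zero differential operator can
    annihilate; but 1 - a acts nontrivially at the origin. *)
Lemma no_left_fixed_point (x g : L) (a : U) : bracket x g != 0 ->
  augmentation a = 0 -> a * envelope_gen x != envelope_gen x.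
Proof.
move=> xg a0; apply/eqP => ax.
have lift0 : envelope_lift (@sym_der k L) (1 - a) != 0.
  apply/eqP => /(congr1 (fun D : endo S => (D 1).@[fun=> 0])).
  rewrite sym_lift_augmented raddfB /= a0 subr0 [augmentation 1]rmorph1.
  rewrite meval1 mul1r meval0.
  by move/eqP; rewrite oner_eq0.
have [] := @twist_annihilator k L (endo S) (@sym_der k L)
  (fun y => mulop (sym_gen (bracket y g))) _ _ _ _ (@is_diffop k S)
  _ _ _ _ _ (1 - a) x lift0 _.
- exact: sym_der_is_lie_hom.
- move=> b y z; apply: endoP => p; rewrite endoD endoZ /=.
  by rewrite linear_bracketl linearP mulrDl scalerAl.
- by move=> y z; apply: mulopC.
- move=> y z; apply: endoP => p; rewrite !endoB !endoM.
  rewrite ![endo_fun (mulop _) _]/=.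
  rewrite !sym_derM !sym_der_gen !addrK -mulrBl -linearB.
  by rewrite bracket_jacobi.
- by move=> b; exists 1%N; apply: diffop_scalar.
- exact: is_diffopD.
- exact: is_diffopM.
- by move=> y; exists 2%N; apply: diffop_derivation => p q; apply: sym_derM.
- by move=> y; exists 1%N; apply: diffop_mulop.
- by rewrite mulrBl mul1r ax subrr.
move=> T [T0 Tdiff Tx]; case/negP: T0; apply/eqP.
apply: diffop_mulop_eq0 Tdiff Tx; apply/lregP.
by apply: contra xg => /eqP/sym_gen_inj->.
Qed.

End NoLeftFixedPoint.

(** * Noetherian Rees algebras: the Lie algebra is nilpotent *)

Section NoetherianImpliesNilpotent.

Context (k : fieldType) (L : finLieAlgType k).
Local Notation U := (envelope L).
Local Notation I := (augmentation_ideal L).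

(** Otherwise the dimensions would decrease strictly for ever. *)
Lemma lower_central_stable : exists n, forall x,
  lower_central L n x -> lower_central L n.+1 x.
Proof.
have [V VP] := lower_central_vspaces L.
have Vdecr n : (V n.+1 <= V n)%VS.
  by apply/subvP => x /VP xn; apply/VP; apply: lower_central_decr.
apply: contrapT => unstable.
suff dimV n : (\dim (V n) + n <= \dim {:L})%N.
  have := dimV (\dim {:L}).+1.
  by rewrite addnS ltnNge leq_addl.
elim: n => [|n IHn]; first by rewrite addn0 dimvS // subvf.
apply: leq_trans IHn; rewrite addnS ltn_add2r.
rewrite (ltn_leqif (dimv_leqif_sup (Vdecr n))).
apply/negP => VnS; apply: unstable; exists n => x /VP xn; apply/VP.
exact: subvP VnS x xn.
Qed.

(** The ideal of all p with coefficients in U x contains x X^d. When d exceeds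
    the degrees of its generators, only the terms of positive degree of their
    multipliers contribute in degree d, and those have coefficients in I. *)
Lemma noetherian_fixed_point (x : L) :
  graded_left_noetherian (rees_grading I) ->
  (forall n, ideal_pow I n (envelope_gen x)) ->
  exists2 a, augmentation a = 0 & a * envelope_gen x = envelope_gen x.
Proof.
set w := envelope_gen x => noeth wI.
pose Uw : set U := [set v | exists b, v = b * w]%classic.
have UwD u v : Uw u -> Uw v -> Uw (u + v).
  by move=> [b ->] [b' ->]; exists (b + b'); rewrite mulrDl.
have UwM u v : Uw v -> Uw (u * v).
  by move=> [b ->]; exists (u * b); rewrite mulrA.
have Uw0 : Uw 0 by exists 0; rewrite mul0r.
pose J : set (rees I) := [set p | forall n, Uw (rees_val p)`_n]%classic.
have Jgraded : graded_left_ideal (rees_grading I) J.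
  split; first split.
  - by move=> n; rewrite [rees_val _](raddf0 (val : rees I -> {poly U})) coef0.
  - move=> p q Jp Jq n.
    rewrite [rees_val _](raddfD (val : rees I -> {poly U})) coefD.
    exact: UwD.
  - move=> p q Jq n.
    rewrite [rees_val _](rmorphM (val : rees I -> {poly U})) coefM.
    by apply: (big_ind Uw) => // i _; apply: UwM.
  move=> p Jp.
  have cP (n : nat) : (rees_val p)`_n *: 'X^n \in rees_pred I.
    apply/rees_predP=> i; rewrite coefZ coefXn; case: eqP => [->|_].
      by rewrite mulr1; case: (p) => q /= /rees_predP.
    by rewrite mulr0; have [] := ideal_pow_left I i.
  exists (size (rees_val p)), (fun i => Rees (cP i)); split=> [i|].
    split=> j; rewrite /= coefZ coefXn; first by move=> /negPf->; rewrite mulr0.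
    by case: (_ == _); rewrite ?mulr1 ?mulr0.
  apply: (val_inj : injective (@rees_val _ I)).
  by rewrite rees_val_sum /= -poly_def coefK.
have [m [g gP]] := noeth J Jgraded.
have gJ i : J (g i).
  apply/gP; exists (fun j => (j == i)%:R).
  rewrite (bigD1 i) //= eqxx mul1r big1 ?addr0 // => j /negPf->.
  exact: mul0r.
(* At least the size, so strictly above the degree, of every generator. *)
pose d := \max_(i < m) size (rees_val (g i)).
have wP : w%:P * 'X^d \in rees_pred I.
  apply/rees_predP=> i; rewrite coefCM coefXn; case: eqP => [->|_].
    by rewrite mulr1.
  by rewrite mulr0; have [] := ideal_pow_left I i.
have [|c wE] := proj1 (gP (Rees wP)).
  move=> n; rewrite /= coefCM coefXn; case: (_ == _); last by rewrite mulr0.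
  by rewrite mulr1; exists 1; rewrite mul1r.
have {wE} wE : w = \sum_i \sum_(j < d.+1)
    (rees_val (c i))`_j * (rees_val (g i))`_(d - j).
  have := congr1 (fun p => (rees_val p)`_d) wE.
  rewrite /= coefCM coefXn eqxx mulr1 rees_val_sum coef_sum => ->.
  apply: eq_bigr => i _.
  by rewrite [rees_val _](rmorphM (val : rees I -> {poly U})) coefM.
suff [a a0 aw] : exists2 a, augmentation a = 0 & w = a * w.
  by exists a => //; rewrite -aw.
pose Iw : set U := [set v | exists2 a, augmentation a = 0 & v = a * w]%classic.
suff : Iw w by [].
have IwD u v : Iw u -> Iw v -> Iw (u + v).
  move=> [a a0 ->] [b b0 ->]; exists (a + b); last by rewrite mulrDl.
  by rewrite raddfD /= a0 b0 addr0.
have Iw0 : Iw 0 by exists 0; rewrite ?raddf0 ?mul0r.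
rewrite wE; apply: (big_ind Iw) => // i _.
apply: (big_ind Iw) => // -[j jd] _ /=.
(* For j = 0 the coefficient of degree d of a generator is involved: it is 0. *)
case: j jd => [|j] jd.
  by rewrite subn0 [X in _ * X]nth_default ?mulr0 //; apply: (leq_bigmax i).
have [b ->] := gJ i (d - j.+1)%N.
exists ((rees_val (c i))`_j.+1 * b); last by rewrite mulrA.
apply: augmentation_kernel_right.
have : ideal_pow I j.+1 (rees_val (c i))`_j.+1.
  by case: (c i) => q qI; apply: (rees_predP _ _ qI).
move=> [p [y [z [yzI ->]]]]; rewrite /augmentation_kernel /= raddf_sum.
rewrite big1 // => l _.
have [yI _] := yzI l.
by have := augmentation_kernel_right (z l) yI.
Qed.

(** Each element of the stable term W of the lower central series is a sum of
    brackets with elements of W, which lie in all powers of I, and such elements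
    are central. *)
Lemma rees_noetherian_nilpotent :
  graded_left_noetherian (rees_grading I) -> nilpotent_lie L.
Proof.
move=> noeth; have [n stable] := lower_central_stable; exists n.
have stable_ge m : forall x,
    lower_central L (m + n) x -> lower_central L (m + n).+1 x.
  elim: m => [//|m IHm] x [p [c [u [v [vm ->]]]]].
  exists p, c, u, v; split=> // i; exact/IHm/vm.
have deep m x : lower_central L n x -> lower_central L (m + n) x.
  by move=> xn; elim: m => [//|m IHm]; apply: stable_ge.
move=> x /stable [p [c [u [v [vn ->]]]]].
apply: big1 => i _; have [uv|uv] := eqVneq (bracket (v i) (u i)) 0.
  by rewrite bracketC uv oppr0 scaler0.
have [m|a a0 av] := noetherian_fixed_point noeth (x := v i).
  by apply: ideal_pow_mono (lower_central_ideal_pow (deep m _ (vn i)));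
    rewrite -addnS leq_addr.
by have := no_left_fixed_point uv a0; rewrite av eqxx.
Qed.

End NoetherianImpliesNilpotent.

Theorem theorem1p3 (k : fieldType) (L : finLieAlgType k) :
  graded_left_noetherian (rees_grading (augmentation_ideal L)) <->
  nilpotent_lie L.
Proof.
split; first exact: rees_noetherian_nilpotent.
exact: nilpotent_rees_noetherian.
Qed.
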